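(* If $A$ is semi-bounded (from below), then $\|(Q_n-E)u\|_{\mathfrak{a}}\to 0$ as $n\to\infty$ for all $u\in\mathcal{H}_{\mathfrak{a}}$.
   Context: $\mathcal{H}$ is a Hilbert space with inner product $\langle\cdot,\cdot\rangle$ and norm $\|\cdot\|$. $A$ is a self-adjoint operator on $\mathcal{H}$, semi-bounded from below; $\mathfrak{a}$ is its (closed) quadratic form, and $m:=\min\sigma(A)$. $\mathcal{H}_{\mathfrak{a}}$ is the Hilbert space $\mathrm{Dom}(\mathfrak{a})$ with inner product $\langle u,v\rangle_{\mathfrak{a}}:=\mathfrak{a}[u,v]-(m-1)\langle u,v\rangle$ and norm $\|u\|_{\mathfrak{a}}=\|(A-m+1)^{1/2}u\|$. $a<b$ are real numbers in the resolvent set $\rho(A)$, $\Delta=[a,b]$, and $\sigma_{\mathrm{ess}}(A)\cap\Delta=\varnothing$. $\mathcal{L}(\Delta)$ is the (finite-dimensional) spectral subspace of $A$ associated to $\sigma(A)\cap\Delta$, and $E$ is the orthogonal projection of $\mathcal{H}$ onto $\mathcal{L}(\Delta)$; $\mathrm{Rank}(E)=d<\infty$. $(\mathcal{L}_n)$ is a sequence of finite-dimensional subspaces of $\mathcal{H}_{\mathfrak{a}}$ such that for every $u\in\mathrm{Dom}(\mathfrak{a})$ there are $u_n\in\mathcal{L}_n$ with $\|u-u_n\|_{\mathfrak{a}}\to 0$. $A_n$ is the self-adjoint operator on $\mathcal{L}_n$ with $\langle A_nu,v\rangle=\mathfrak{a}[u,v]$ for all $u,v\in\mathcal{L}_n$.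 $\mathcal{L}_n(\Delta)\subset\mathcal{L}_n$ is the span of the eigenvectors of $A_n$ with eigenvalues in $\Delta$, and $Q_n$ is the orthogonal projection (with respect to $\langle\cdot,\cdot\rangle$) of $\mathcal{H}$ onto $\mathcal{L}_n(\Delta)$. *)

(* Defs.v *)
From HB Require Import structures.
From mathcomp Require Import all_boot all_order all_algebra complex.
From mathcomp Require Import all_classical all_reals all_analysis.

Set Implicit Arguments.
Unset Strict Implicit.
Unset Printing Implicit Defensive.

Import Order.TTheory GRing.Theory Num.Theory.
Import numFieldNormedType.Exports.

Local Open Scope classical_set_scope.
Local Open Scope complex_scope.
Local Open Scope ring_scope.

Section LinearAlgebra.
Context {R : realType} {H : lmodType R[i]}.
Implicit Types (S L : set H).

Definition is_subspace L :=
  L 0 /\ forall (c : R[i]) u v, L u -> L v -> L (c *: u + v).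

Definition lspan S : set H :=
  [set x | exists (n : nat) (c : 'I_n -> R[i]) (v : 'I_n -> H),
     (forall i, S (v i)) /\ x = \sum_(i < n) c i *: v i].

Definition finite_dim L := exists (n : nat) (v : 'I_n -> H), L = lspan (range v).

End LinearAlgebra.

(* Unbounded operators and forms on subspaces are total functions together with
   a domain; the values taken outside of the domain are never used. *)
Record operator (V : Type) := Operator { odom : set V; oapp :> V -> V }.

Record sform (R : realType) (V : Type) :=
  SForm { fdom : set V; fval :> V -> V -> R[i] }.

Section HilbertSpace.
Context {R : realType} {H : completeNormedModType R[i]}.
Variable ip : {dot H for @Num.conj R[i]}.
Implicit Types (A T : operator H) (q : sform R H) (L : set H).

(* Linear in the first argument; the norm of [H] is the one of [ip].  Together
   with the completeness of [H] this makes [H] a complex Hilbert space. *)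
Definition norm_from_ip := forall u : H, ip u u = `|u| ^+ 2.

Definition orth_proj L (Q : H -> H) :=
  forall u, L (Q u) /\ forall v, L v -> ip (u - Q u) v = 0.

Definition linear_op T :=
  is_subspace (odom T) /\
  forall (c : R[i]) u v, odom T u -> odom T v -> T (c *: u + v) = c *: T u + T v.

(* For a densely defined [T], the graph of the adjoint of [T]. *)
Definition adjoint_graph T (v w : H) :=
  forall u, odom T u -> ip (T u) v = ip u w.

Definition self_adjoint T :=
  [/\ linear_op T, closure (odom T) = setT &
      forall v w, adjoint_graph T v w <-> (odom T v /\ w = T v)].

Definition semibounded_below T :=
  exists c : R, forall u, odom T u -> c%:C * ip u u <= ip (T u) u.

Definition resolvent_set T : set R[i] :=
  [set z | exists2 S : {linear H -> H}, continuous S &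
     (forall w, odom T (S w) /\ T (S w) - z *: S w = w) /\
     (forall u, odom T u -> S (T u - z *: u) = u)].

Definition spectrum T : set R[i] := ~` resolvent_set T.

(* In [R[i]], [m%:C <= z] means that [z] is real and not smaller than [m]. *)
Definition is_min_spectrum T (m : R) :=
  spectrum T m%:C /\ forall z, spectrum T z -> m%:C <= z.

Definition eigenspace T (z : R[i]) : set H := [set u | odom T u /\ T u = z *: u].

Definition discrete_spectrum T : set R[i] :=
  [set z | [/\ isolated (spectrum T : set R[i]^o) z,
               exists2 u, eigenspace T z u & u != 0 &
               finite_dim (eigenspace T z)]].

Definition essential_spectrum T : set R[i] :=
  spectrum T `\` discrete_spectrum T.

(* [P] is a projection-valued measure on the Borel sets of the real line and
   [mu u] is the scalar measure B |-> <P(B)u, u>. *)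
Definition projection_valued_measure (P : set R -> H -> H)
    (mu : H -> {measure set (measurableTypeR R) -> \bar R}) :=
  [/\ forall B : set (measurableTypeR R), measurable B ->
        (forall u, P B (P B u) = P B u) /\
        (forall u v, ip (P B u) v = ip u (P B v)),
      forall u, P setT u = u,
      forall B C : set (measurableTypeR R), measurable B -> measurable C ->
        forall u, P (B `&` C) u = P B (P C u) &
      forall u (B : set (measurableTypeR R)), measurable B ->
        mu u B = (complex.Re (ip (P B u) u))%:E].

(* A = \int x dP(x): the domain of A consists of the u with
   \int x^2 d<P(x)u, u> < +oo, and <Au, u> = \int x d<P(x)u, u> for such u;
   by polarization the latter determines A. *)
Definition spectral_measure_of A (P : set R -> H -> H) :=
  exists mu : H -> {measure set (measurableTypeR R) -> \bar R},
  [/\ projection_valued_measure P mu,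
      forall u, odom A u <-> (\int[mu u]_x (x ^+ 2)%:E < +oo)%E &
      forall u, odom A u ->
        (\int[mu u]_x x%:E = (complex.Re (ip (A u) u))%:E)%E].

Definition spectral_subspace (P : set R -> H -> H) (D : set R) : set H :=
  range (P D).

Definition hermitian_form q :=
  [/\ is_subspace (fdom q),
      forall (c : R[i]) u v w, fdom q u -> fdom q v -> fdom q w ->
        q (c *: u + v) w = c * q u w + q v w &
      forall u v, fdom q u -> fdom q v -> q v u = Num.conj (q u v)].

Definition form_semibounded_below q :=
  exists c : R, forall u, fdom q u -> c%:C * ip u u <= q u u.

Definition closed_form q :=
  forall (u_ : nat -> H) (u : H), (forall n, fdom q (u_ n)) ->
    u_ n @[n --> \oo] --> u ->
    complex.Re (q (u_ p.1 - u_ p.2) (u_ p.1 - u_ p.2)) @[p --> (\oo, \oo)]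
      --> (0 : R) ->
    fdom q u /\ complex.Re (q (u_ n - u) (u_ n - u)) @[n --> \oo] --> (0 : R).

(* [q] is the closed form of [A] in the sense of the first representation
   theorem: [A] is the operator associated with [q]. *)
Definition form_of A q :=
  [/\ hermitian_form q, form_semibounded_below q, closed_form q &
      forall u w, (odom A u /\ w = A u) <->
                  (fdom q u /\ forall v, fdom q v -> q u v = ip w v)].

(* The inner product and the norm of the Hilbert space [fdom q]; to be used only
   on elements of [fdom q], with [m] the minimum of the spectrum. *)
Definition form_ip q (m : R) (u v : H) : R[i] := q u v - (m - 1)%:C * ip u v.

Definition form_norm q (m : R) (u : H) : R :=
  Num.sqrt (complex.Re (form_ip q m u u)).

(* [T] is the operator on the space [L] representing the restriction of [q]. *)
Definition galerkin_op q L T :=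
  [/\ linear_op T, odom T = L, forall u, L u -> L (T u) &
      forall u v, L u -> L v -> ip (T u) v = q u v].

Definition eigen_span T (D : set R) : set H :=
  lspan [set u | u != 0 /\ exists2 x : R, D x & eigenspace T x%:C u].

End HilbertSpace.

(* Main.v *)
Require Import Defs.
From HB Require Import structures.
From mathcomp Require Import all_boot all_order all_algebra complex.
From mathcomp Require Import all_classical all_reals all_analysis.
From mathcomp Require Import ring lra spectral measurable_realfun.

Set Implicit Arguments.
Unset Strict Implicit.
Unset Printing Implicit Defensive.

Import Order.TTheory GRing.Theory Num.Theory.
Import numFieldNormedType.Exports.

Local Open Scope classical_set_scope.
Local Open Scope complex_scope.
Local Open Scope ring_scope.

(** Eigenvalues of the Galerkin operators An may accumulate at points of the
    window [a, b] that are not in the spectrum of A, and even at its end points,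
    so Q n need not converge to E in norm and contour integrals are of no help.
    Strong convergence holds nevertheless, by the following argument.

    Put c = (a + b) / 2, r = (b - a) / 2, z = c + i and rho = sqrt (r ^ 2 + 1).
    For real x, |x - z| <= rho exactly when x lies in [a, b].  Consider
    F = rho (A - z)^-1 and its Galerkin counterpart F_n, the map sending w to
    the y in L n with q(y, v) - z <y, v> = rho <w, v> for all v in L n.
    - As a and b are in the resolvent set, the spectral measure of A vanishes
      within some distance d > 0 of a and of b.  Hence F is a strict contraction
      of ker E, and F^-1 is a strict contraction of ran E
      ([spectral_window], [resolvent_window]).
    - On an orthonormal eigenbasis of An one sees that F_n does not decrease
      norms on the range of Q n and does not increase them on its complement in
      L n ([galerkin_resolvent]).  Neither holds with a factor bounded away from 1
      uniformly in n, as eigenvalues of An may approach a and b.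
    - F_n w tends to F w for every w, by Cea's lemma ([cea_estimate]).
    For v in ker E this gives limsup |Q n v| <= limsup |Q n (F v)|, and hence
    limsup |Q n v| <= |F^k v| for all k, which tends to 0 with k.  For v in
    ran E, likewise, limsup |v - Q n v| <= |F^-k v|.  Both limits are instances
    of [iterate_contraction].  Splitting u into E u and u - E u yields the
    convergence of Q n u to E u in the norm of H.

    For the form norm ([energy_proj_le], [energy_compl_le]) the part Q n (u - E u)
    is harmless, since the form is bounded by b on the range of Q n.  For
    v = E u, which is in the domain of A, approximate v by w in L n; then
    y = w - Q n w is orthogonal to Q n w for the form too, whence
    |y|_a ^ 2 = <w, y>_a = <(A - m + 1) v, y> - <v - w, y>_a, which is small
    because y is small in H.

    That the form norm is a norm at all requires the form to be bounded below
    by the minimum m of the spectrum ([form_ge_min_spectrum]). *)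

(** * Positive Hermitian forms on a subspace *)

Section Forms.
Context {R : realType} {H : completeNormedModType R[i]}.
Implicit Types (q : sform R H) (u v w : H) (c : R[i]).

Definition psd_form q :=
  hermitian_form q /\ forall u, fdom q u -> 0 <= complex.Re (q u u).

Definition seminorm q u : R := Num.sqrt (complex.Re (q u u)).

Section Hermitian.
Variables (q : sform R H) (hq : hermitian_form q).

Lemma fdom0 : fdom q 0. Proof. by case: hq => -[]. Qed.

Lemma fdom_lin c u v : fdom q u -> fdom q v -> fdom q (c *: u + v).
Proof. by case: hq => -[_ + _ _]; apply. Qed.

Lemma fdomD u v : fdom q u -> fdom q v -> fdom q (u + v).
Proof. by rewrite -{2}[u]scale1r; exact: fdom_lin. Qed.

Lemma fdomZ c u : fdom q u -> fdom q (c *: u).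
Proof. by move=> du; rewrite -[_ *: _]addr0; apply: fdom_lin => //; exact: fdom0. Qed.

Lemma fdomN u : fdom q u -> fdom q (- u).
Proof. by rewrite -scaleN1r; exact: fdomZ. Qed.

Lemma fdomB u v : fdom q u -> fdom q v -> fdom q (u - v).
Proof. by move=> du dv; apply: fdomD => //; exact: fdomN. Qed.

Lemma formC u v : fdom q u -> fdom q v -> q v u = conjc (q u v).
Proof. by case: hq => _ _ + du dv => ->. Qed.

Lemma formDl u v w : fdom q u -> fdom q v -> fdom q w ->
  q (u + v) w = q u w + q v w.
Proof.
by move=> du dv dw; case: hq => _ + _ => /(_ 1 u v w du dv dw); rewrite scale1r mul1r.
Qed.

Lemma form0l w : fdom q w -> q 0 w = 0.
Proof.
move=> dw; have := formDl fdom0 fdom0 dw.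
by rewrite addr0 => /(congr1 (fun x => x - q 0 w)); rewrite addrK subrr.
Qed.

Lemma formZl c u w : fdom q u -> fdom q w -> q (c *: u) w = c * q u w.
Proof.
move=> du dw; case: hq => _ /(_ c u 0 w du fdom0 dw) + _.
by rewrite form0l // !addr0.
Qed.

Lemma formNl u w : fdom q u -> fdom q w -> q (- u) w = - q u w.
Proof. by move=> du dw; rewrite -scaleN1r formZl // mulN1r. Qed.

Lemma formBl u v w : fdom q u -> fdom q v -> fdom q w ->
  q (u - v) w = q u w - q v w.
Proof. by move=> du dv dw; rewrite formDl ?formNl //; exact: fdomN. Qed.

Lemma formDr u v w : fdom q u -> fdom q v -> fdom q w ->
  q w (u + v) = q w u + q w v.
Proof.
move=> du dv dw; rewrite formC ?formDl ?rmorphD //=; last exact: fdomD.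
by rewrite -!formC.
Qed.

Lemma formZr c u w : fdom q u -> fdom q w -> q w (c *: u) = conjc c * q w u.
Proof.
move=> du dw; rewrite formC ?formZl ?rmorphM //=; last exact: fdomZ.
by rewrite -formC.
Qed.

Lemma formNr u w : fdom q u -> fdom q w -> q w (- u) = - q w u.
Proof. by move=> du dw; rewrite -scaleN1r formZr // rmorphN rmorph1 mulN1r. Qed.

Lemma formBr u v w : fdom q u -> fdom q v -> fdom q w ->
  q w (u - v) = q w u - q w v.
Proof. by move=> du dv dw; rewrite formDr ?formNr //; exact: fdomN. Qed.

Lemma form_ReC u v : fdom q u -> fdom q v -> complex.Re (q v u) = complex.Re (q u v).
Proof. by move=> du dv; rewrite formC//; case: (q u v). Qed.

Lemma form_Im u : fdom q u -> complex.Im (q u u) = 0.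
Proof.
move=> du; have := formC du du; case: (q u u) => x y /= [] /eqP.
by rewrite -addr_eq0 -mulr2n mulrn_eq0 /= => /eqP.
Qed.

Lemma form_ReD u v : fdom q u -> fdom q v -> complex.Re (q (u + v) (u + v)) =
  complex.Re (q u u) + 2 * complex.Re (q u v) + complex.Re (q v v).
Proof.
move=> du dv; rewrite formDl ?formDr //; last exact: fdomD.
have := form_ReC du dv.
by case: (q v u) (q u v) (q u u) (q v v) => ? ? [? ?] [? ?] [? ?] /= ->; ring.
Qed.

Lemma form_ReZ c u : fdom q u ->
  complex.Re (q (c *: u) (c *: u)) =
  (complex.Re c ^+ 2 + complex.Im c ^+ 2) * complex.Re (q u u).
Proof.
move=> du; rewrite formZl ?formZr //; last exact: fdomZ.
have := form_Im du.
by case: c (q u u) => ? ? [? ?] /= ->; ring.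
Qed.

End Hermitian.

(** A nonnegative quadratic polynomial in [t] has a nonpositive
    discriminant; this is what Cauchy-Schwarz reduces to. *)
Lemma discriminant_le (A B C : R) : 0 <= A ->
  (forall t : R, 0 <= t ^+ 2 * A + 2 * t * B + C) -> B ^+ 2 <= A * C.
Proof.
rewrite le_eqVlt => /predU1P[<-|A0] h.
- rewrite mul0r; have [->|B0] := eqVneq B 0; first by rewrite expr0n.
  have := h (- (C + 1) / (2 * B)).
  have -> : (- (C + 1) / (2 * B)) ^+ 2 * 0 + 2 * (- (C + 1) / (2 * B)) * B + C = -1.
    by field.
  by lra.
- have := h (- B / A).
  have -> : (- B / A) ^+ 2 * A + 2 * (- B / A) * B + C = C - B ^+ 2 / A.
    by field; rewrite gt_eqF.
  by rewrite subr_ge0 ler_pdivrMr // mulrC.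
Qed.

Section PSD.
Variables (q : sform R H) (hq : psd_form q).
Let hh := hq.1.

Lemma seminorm_ge0 u : 0 <= seminorm q u. Proof. exact: sqrtr_ge0. Qed.

Lemma sqr_seminorm u : fdom q u -> seminorm q u ^+ 2 = complex.Re (q u u).
Proof. by move=> du; rewrite sqr_sqrtr //; exact: hq.2. Qed.

Lemma seminormZ c u : fdom q u ->
  seminorm q (c *: u) = Num.sqrt (complex.Re c ^+ 2 + complex.Im c ^+ 2) * seminorm q u.
Proof. by move=> du; rewrite /seminorm form_ReZ // sqrtrM // addr_ge0 ?sqr_ge0. Qed.

Lemma seminormN u : fdom q u -> seminorm q (- u) = seminorm q u.
Proof.
move=> du; rewrite -scaleN1r seminormZ //=.
by rewrite oppr0 expr0n addr0 sqrrN expr1n sqrtr1 mul1r.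
Qed.

(** Real and imaginary parts are bounded separately, which avoids complex
    moduli; the second bound is the first one for ['i *: u]. *)
Lemma form_CauchySchwarz_Re u v : fdom q u -> fdom q v ->
  `|complex.Re (q u v)| <= seminorm q u * seminorm q v.
Proof.
move=> du dv; rewrite -ler_sqr ?nnegrE ?mulr_ge0 ?seminorm_ge0 //.
rewrite exprMn !sqr_seminorm // real_normK ?num_real //.
apply: discriminant_le => [|t]; first exact: hq.2.
have := hq.2 (t%:C *: u + v) (fdom_lin hh _ du dv).
rewrite form_ReD // ?form_ReZ ?formZl //=; last exact: fdomZ.
by case: (q u v) => ? ? /=; rewrite expr0n /= mul0r subr0 addr0 mulrA.
Qed.

Lemma form_CauchySchwarz_Im u v : fdom q u -> fdom q v ->
  `|complex.Im (q u v)| <= seminorm q u * seminorm q v.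
Proof.
move=> du dv; have := form_CauchySchwarz_Re (fdomZ hh 'i%C du) dv.
rewrite seminormZ //= expr0n expr1n add0r sqrtr1 mul1r formZl //.
by case: (q u v) => x y /=; rewrite mul0r mul1r sub0r normrN.
Qed.

Lemma ler_seminormD u v : fdom q u -> fdom q v ->
  seminorm q (u + v) <= seminorm q u + seminorm q v.
Proof.
move=> du dv; rewrite -ler_sqr ?nnegrE ?addr_ge0 ?seminorm_ge0 //.
rewrite sqr_seminorm ?form_ReD //; last exact: fdomD.
have := form_CauchySchwarz_Re du dv; rewrite ler_norml => /andP[_ h].
rewrite sqrrD !sqr_seminorm //.
by lra.
Qed.

Lemma ler_seminormB u v : fdom q u -> fdom q v ->
  seminorm q (u - v) <= seminorm q u + seminorm q v.
Proof.
move=> du dv; rewrite -(seminormN dv).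
by apply: ler_seminormD => //; exact: fdomN.
Qed.

End PSD.
End Forms.

(** * The form domain, its lower bound and Cea's lemma *)

Section Hilbert.
Context {R : realType} {H : completeNormedModType R[i]}.
Variable ip : {dot H for @Num.conj R[i]}.
Implicit Types (q : sform R H) (u v w : H).

(** The norm of [H] and the form norm are both treated as the seminorm of a
    positive form on a subspace, so that they share one Cauchy-Schwarz
    inequality. *)
Definition ip_form : sform R H := SForm setT (fun u v => ip u v).
Definition energy_form q (m : R) : sform R H := SForm (fdom q) (form_ip ip q m).

Local Notation nrm := (seminorm ip_form).

Lemma ipC u v : ip v u = conjc (ip u v).
Proof. by rewrite hermC /= expr0 mul1r. Qed.

Lemma ipZl c u w : ip (c *: u) w = c * ip u w.
Proof. exact: linearZl_LR. Qed.

Lemma ipZr c u w : ip w (c *: u) = conjc c * ip w u.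
Proof. exact: linearZr_LR. Qed.

Lemma ip_form_psd : psd_form ip_form.
Proof.
split=> [|u _]; last by have := dnorm_ge0 ip u; rewrite lecE => /andP[].
split=> //= [c u v w _ _ _|u v _ _]; last exact: ipC.
by rewrite linearPl.
Qed.

Lemma nrm0 : nrm 0 = 0.
Proof. by rewrite /seminorm /= linear0l sqrtr0. Qed.

Lemma ip_nrm u : ip u u = (nrm u ^+ 2)%:C.
Proof.
have := form_Im ip_form_psd.1 (I : fdom ip_form u).
rewrite (sqr_seminorm ip_form_psd) //=.
by case: (ip u u) => x y /= ->.
Qed.

Lemma Re_ip u : complex.Re (ip u u) = nrm u ^+ 2.
Proof. by rewrite ip_nrm. Qed.

Lemma nrm_eq0 u : nrm u = 0 -> u = 0.
Proof.
move=> u0; apply/eqP; rewrite -(dnorm_eq0 ip) ip_nrm u0 expr0n //.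
Qed.

Lemma nrmZ_real (c : R) u : nrm (c%:C *: u) = `|c| * nrm u.
Proof. by rewrite (seminormZ ip_form_psd) //= expr0n addr0 sqrtr_sqr. Qed.

Lemma nrmD u v : nrm (u + v) <= nrm u + nrm v.
Proof. exact: (ler_seminormD ip_form_psd). Qed.

Lemma nrmB u v : nrm (u - v) <= nrm u + nrm v.
Proof. exact: (ler_seminormB ip_form_psd). Qed.

Lemma nrm_pythagoras u v : ip u v = 0 -> nrm (u + v) ^+ 2 = nrm u ^+ 2 + nrm v ^+ 2.
Proof. by move=> uv; rewrite -!Re_ip (form_ReD ip_form_psd.1 I I) /= uv mulr0 addr0. Qed.

Hypothesis hip : norm_from_ip ip.

Lemma norm_nrm u : `|u| = (nrm u)%:C :> R[i].
Proof.
apply/eqP; rewrite -(@eqrXn2 _ 2) //; last by rewrite ler0c seminorm_ge0.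
by rewrite -hip ip_nrm rmorphXn.
Qed.

Lemma continuous_linear_nrm_bounded (S : {linear H -> H}) : continuous S ->
  exists2 M : R, 0 < M & forall w, nrm (S w) <= M * nrm w.
Proof.
move=> /(_ 0) cS; have := (continuous_linear_bounded 0 cS).
move=> /linear_boundedP bS.
near (+oo : set_system R[i]) => M.
have M0 : 0 < M by near: M; exact: nbhs_pinfty_gt.
exists (complex.Re M); first by move: M0; rewrite ltcE => /andP[].
move=> w; have : `|S w| <= M * `|w| by move: w; near: M.
have -> : M = (complex.Re M)%:C by rewrite RRe_real // gtr0_real.
by rewrite !norm_nrm -rmorphM lecR.
Unshelve. all: by end_near.
Qed.

Section SemiboundedForm.
Variables (q : sform R H) (hq : hermitian_form q).

Definition form_ge (l : R) := forall u, fdom q u -> l * nrm u ^+ 2 <= complex.Re (q u u).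

Lemma energy_form_hermitian m : hermitian_form (energy_form q m).
Proof.
split; first by case: hq.
- move=> c u v w du dv dw /=; rewrite /form_ip linearPl.
  by case: hq => _ -> // _; ring.
- move=> u v du dv /=; rewrite /form_ip; case: hq => _ _ -> //.
  by rewrite (ipC u v); case: (q u v) (ip u v) => ? ? [? ?]; congr Complex => /=; ring.
Qed.

Lemma energy_formE m u : complex.Re (energy_form q m u u) =
  complex.Re (q u u) - (m - 1) * nrm u ^+ 2.
Proof.
by rewrite /= /form_ip ip_nrm; case: (q u u) => x y /=; rewrite mul0r subr0.
Qed.

Lemma energy_form_psd m : form_ge (m - 1) -> psd_form (energy_form q m).
Proof.
move=> qm; split; first exact: energy_form_hermitian.
by move=> u du; rewrite energy_formE subr_ge0; exact: qm.
Qed.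

Lemma nrm_le_energy m u : form_ge m -> fdom q u ->
  nrm u <= seminorm (energy_form q m) u.
Proof.
move=> qm du; apply: ler_wsqrtr.
rewrite energy_formE /= Re_ip.
by have := qm u du; lra.
Qed.

End SemiboundedForm.

Section FormOf.
Variables (A : operator H) (q : sform R H) (Aq : form_of ip A q).

Lemma form_of_fdom u : odom A u -> fdom q u.
Proof. by case: Aq => _ _ _ + Du; case/(_ u (A u)) => /(_ (conj Du erefl)) []. Qed.

Lemma form_ofE u v : odom A u -> fdom q v -> q u v = ip (A u) v.
Proof.
by case: Aq => _ _ _ + Du; case/(_ u (A u)) => /(_ (conj Du erefl)) [_ +] _; apply.
Qed.

(** If the form of [A - l] is nonnegative and [S] inverts [A - l], then
    Cauchy-Schwarz for this form, applied to [S u] and [u], gives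
    [|u| ^ 4 <= <u, S u> (q(u, u) - l |u| ^ 2) <= |S| |u| ^ 2 (q(u, u) - l |u| ^ 2)],
    so the bound [l] can be raised by [1 / |S|]. *)
Lemma form_ge_improve (l : R) : resolvent_set A l%:C -> form_ge q l ->
  exists2 e : R, 0 < e & form_ge q (l + e).
Proof.
case: (Aq) => hq _ _ _ [S cS [SA _]] ql.
have [M M0 SM] := continuous_linear_nrm_bounded cS.
exists M^-1; first by rewrite invr_gt0.
move=> u du; have [Dv Ev] := SA u; set v := S u in Dv Ev.
have dv := form_of_fdom Dv.
have hp : psd_form (energy_form q (l + 1)) by apply: energy_form_psd; rewrite ?addrK.
have E1 w : fdom q w -> energy_form q (l + 1) v w = ip u w.
  by move=> dw; rewrite /= /form_ip addrK form_ofE // -[in RHS]Ev linearBl /= ipZl.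
have := form_CauchySchwarz_Re hp dv du; rewrite E1 // ip_nrm /=.
have -> : `|nrm u ^+ 2| = nrm u ^+ 2 by rewrite ger0_norm // sqr_ge0.
have := sqr_seminorm hp dv; rewrite E1 //.
have := sqr_seminorm hp du; rewrite energy_formE addrK.
have := seminorm_ge0 (energy_form q (l + 1)) v.
have := seminorm_ge0 (energy_form q (l + 1)) u.
have := form_CauchySchwarz_Re ip_form_psd (I : fdom ip_form u) (I : fdom ip_form v).
rewrite ler_norml /= => /andP[_].
have := SM u; rewrite -/v.
set N := seminorm _ v; set X := seminorm (energy_form _ _) v.
set Y := seminorm (energy_form _ _) u.
have : 0 <= nrm u by exact: seminorm_ge0.
set n := nrm u => n0 h1 h2 Y0 X0 h3 h4 h5.
have [nE|nn0] := eqVneq n 0.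
  by move: h3; rewrite nE expr0n !mulr0 subr0 => <-; exact: sqr_ge0.
have n1 : 0 < n by rewrite lt_def nn0.
rewrite mulrDl -lerBrDl -h3 mulrC ler_pdivrMr //.
have h6 : X ^+ 2 <= n ^+ 2 * M by rewrite h4; apply: (le_trans h2); nra.
have h7 : (n ^+ 2) ^+ 2 <= X ^+ 2 * Y ^+ 2.
  by rewrite -exprMn ler_sqr ?nnegrE ?mulr_ge0 ?sqr_ge0.
have h8 : (n ^+ 2) ^+ 2 <= (n ^+ 2 * M) * Y ^+ 2.
  by apply: (le_trans h7); rewrite ler_wpM2r ?sqr_ge0.
by move: h8; rewrite expr2 -mulrA ler_pM2l ?exprn_gt0 // mulrC.
Qed.

(** The supremum of the lower bounds of the form is a lower bound.  If it were
    less than [m] it would be in the resolvent set and could be raised. *)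
Lemma form_ge_min_spectrum (m : R) : is_min_spectrum A m -> form_ge q m.
Proof.
case: (Aq) => hq [c0 qc0] _ _ [_ hm].
have res l : l < m -> resolvent_set A l%:C.
  move=> lm; apply: contrapT => /hm; rewrite lecR => /(lt_le_trans lm).
  by rewrite ltxx.
have mono l l' : l <= l' -> form_ge q l' -> form_ge q l.
  by move=> ll' ql' u du; apply: le_trans (ql' u du); rewrite ler_wpM2r ?sqr_ge0.
apply: contrapT => nqm.
pose X := [set l | form_ge q l].
have Xc0 : X c0.
  by move=> u du; have := qc0 u du; rewrite ip_nrm -rmorphM lecE => /andP[_].
have ubX l : X l -> l <= m.
  by move=> Xl; rewrite leNgt; apply/negP => /ltW /mono /(_ Xl).
have supX : has_sup X by split; [exists c0|exists m].
have Xs : X (sup X).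
  move=> u du; have [->|u0] := eqVneq u 0.
    by rewrite nrm0 expr0n mulr0 (form0l hq) //; exact: fdom0.
  have nu : 0 < nrm u ^+ 2.
    by rewrite exprn_gt0 // lt_def seminorm_ge0 andbT; apply: contra_neq u0; exact: nrm_eq0.
  rewrite -ler_pdivlMr //; apply: ge_sup; first by exists c0.
  by move=> l Xl; rewrite ler_pdivlMr //; exact: Xl.
have sm : sup X < m.
  rewrite lt_neqAle ge_sup // ?andbT; last by exists c0.
  by apply/eqP => E; apply: nqm; rewrite -E.
have [e e0 Xe] := form_ge_improve (res _ sm) Xs.
have : sup X + e <= sup X by apply: ub_le_sup => //; exact: supX.2.
by rewrite leNgt ltrDl e0.
Qed.

End FormOf.

Section Cea.
Variables (q : sform R H) (hq : hermitian_form q) (m : R) (qm : form_ge q m).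
Local Notation energy := (seminorm (energy_form q m)).

(** The form [q - z <., .>] with [z = c + i eta] is coercive for the form norm:
    its imaginary part controls [|e| ^ 2], and its real part then controls
    [|e|_a ^ 2].  As the error [e = u - y] is orthogonal to [V] for this form,
    the second argument [e] can be replaced by [u - g]. *)
Lemma cea_estimate (c eta : R) : 0 < eta -> exists2 C : R, 0 < C &
  forall (V : set H) u y g, is_subspace V -> V `<=` fdom q ->
    fdom q u -> V y -> V g ->
    (forall v, V v -> q (u - y) v = (c +i* eta) * ip (u - y) v) ->
    energy (u - y) <= C * energy (u - g).
Proof.
move=> eta0.
exists ((1 + `|c - m + 1| + eta) * (1 + `|c - m + 1| / eta)).
  have d0 := normr_ge0 (c - m + 1).
  by rewrite mulr_gt0 //; [lra|rewrite ltr_pwDl // divr_ge0 // ltW].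
move=> V u y g Vsub Vq du Vy Vg orth.
have hE : psd_form (energy_form q m).
  apply: energy_form_psd => // w dw; apply: le_trans (qm dw).
  by rewrite ler_wpM2r ?sqr_ge0 //; lra.
set e := u - y; set h := u - g; rewrite -/e in orth.
have de : fdom q e by apply: fdomB => //; exact: Vq.
have dh : fdom q h by apply: fdomB => //; exact: Vq.
have Vgy : V (g - y).
  by rewrite addrC -scaleN1r; apply: Vsub.2.
have key : q e e - (c +i* eta) * ip e e = q e h - (c +i* eta) * ip e h.
  apply/eqP; rewrite -subr_eq0; apply/eqP.
  transitivity (q e (e - h) - (c +i* eta) * ip e (e - h)).
    have eB : ip e (e - h) = ip e e - ip e h by exact: linearBr.
    by rewrite (formBr hq) // eB; ring.
  rewrite orth ?subrr //; suff -> : e - h = g - y by [].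
  by rewrite /e /h opprB addrC subrKA.
have := form_CauchySchwarz_Im hE de dh.
have := form_CauchySchwarz_Re hE de dh.
have := form_CauchySchwarz_Im ip_form_psd (I : fdom ip_form e) (I : fdom ip_form h).
have := form_CauchySchwarz_Re ip_form_psd (I : fdom ip_form e) (I : fdom ip_form h).
have := nrm_le_energy qm de; have := nrm_le_energy qm dh.
have := sqr_seminorm hE de; rewrite energy_formE.
have := seminorm_ge0 ip_form e; have := seminorm_ge0 ip_form h.
have := seminorm_ge0 (energy_form q m) e; have := seminorm_ge0 (energy_form q m) h.
move: key; rewrite ip_nrm.
rewrite /= /form_ip.
have := form_Im hq de.
set d := `|c - m + 1|.
have d0 : 0 <= d by exact: normr_ge0.
have := ler_norm (c - m + 1); have := lerNnormlW (lexx d).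
set E := energy e; set G := energy h.
set n := nrm e; set k := nrm h.
case: (q e e) => qe1 qe2; case: (q e h) => q1 q2; case: (ip e h) => i1 i2 /=.
move=> hd1 hd2 -> [] e1 e2 G0 E0 k0 n0 e3 kG nE.
rewrite !ler_norml => /andP[a1 a2] /andP[b1 b2].
move=> /andP[c1 c2] /andP[f1 f2].
set t := c - m + 1 in d d0 hd1 hd2 *.
have nkP : n * k <= E * G by rewrite ler_pM.
have bound x : `|x| <= n * k -> `|t * x| <= d * (E * G).
  by move=> xnk; rewrite normrM ler_pM // (le_trans xnk).
have t1 : `|t * i1| <= d * (E * G) by apply: bound; rewrite ler_norml a1.
have t2 : `|t * i2| <= d * (E * G) by apply: bound; rewrite ler_norml b1.
move: t1 t2; rewrite !ler_norml => /andP[t1 t1'] /andP[t2 t2'].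
have i1P : i1 <= E * G by apply: le_trans nkP.
have i2P : i2 <= E * G by apply: le_trans nkP.
have ei1 : eta * i1 <= eta * (E * G) by rewrite ler_pM2l.
have ei2 : eta * i2 <= eta * (E * G) by rewrite ler_pM2l //.
(* The imaginary part of the Galerkin identity controls the norm of the error. *)
have n2 : n ^+ 2 <= (1 + d + eta) / eta * (E * G).
  rewrite mulrAC ler_pdivlMr //; rewrite /t in t2 t2'; nra.
have tn : t * n ^+ 2 <= d * ((1 + d + eta) / eta * (E * G)).
  apply: (@le_trans _ _ (d * n ^+ 2)); first by rewrite ler_wpM2r ?sqr_ge0.
  by rewrite ler_wpM2l.
(* Its real part, where [t] may have either sign, controls the energy. *)
have E2 : E ^+ 2 <= ((1 + d + eta) * (1 + d / eta) * G) * E.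
  have -> : ((1 + d + eta) * (1 + d / eta) * G) * E =
    (1 + d + eta) * (E * G) + d * ((1 + d + eta) / eta * (E * G)).
    by field; rewrite gt_eqF.
  by rewrite /t in t1 t1' tn; nra.
have [->|E1] := eqVneq E 0.
  by rewrite !mulr_ge0 // addr_ge0 // ?divr_ge0 ?addr_ge0 // ltW.
by rewrite -(ler_pM2r (_ : 0 < E)) // lt_def E1.
Qed.

End Cea.
End Hilbert.

(** * Eigenbases of Galerkin operators *)

Section FiniteDim.
Context {R : realType} {H : completeNormedModType R[i]}.
Variable ip : {dot H for @Num.conj R[i]}.
Implicit Types (V : set H) (q : sform R H) (T : operator H).
Local Notation nrm := (seminorm (ip_form ip)).

Definition orthonormal_basis V k (e : 'I_k -> H) :=
  [/\ forall i j, ip (e i) (e j) = (i == j)%:R, forall i, V (e i) &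
      forall u, V u -> u = \sum_i ip u (e i) *: e i].

Lemma subspace_sum V (I : Type) (r : seq I) (p : pred I) (F : I -> H) :
  is_subspace V -> (forall i, V (F i)) -> V (\sum_(i <- r | p i) F i).
Proof.
move=> Vs VF; apply: big_ind => //; first exact: Vs.1.
by move=> u v Vu Vv; rewrite -[u]scale1r; exact: Vs.2.
Qed.

Lemma subspaceZ V c u : is_subspace V -> V u -> V (c *: u).
Proof. by move=> Vs Vu; rewrite -[_ *: _]addr0; apply: Vs.2 => //; exact: Vs.1. Qed.

Lemma subspaceB V u v : is_subspace V -> V u -> V v -> V (u - v).
Proof. by move=> Vs Vu Vv; rewrite addrC -scaleN1r; exact: Vs.2. Qed.

Lemma ip_suml n (c : 'I_n -> R[i]) (e : 'I_n -> H) (p : pred 'I_n) w :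
  ip (\sum_(i | p i) c i *: e i) w = \sum_(i | p i) c i * ip (e i) w.
Proof. by rewrite linear_sumlz; apply: eq_bigr => i _ /=; rewrite ipZl. Qed.

Lemma ip_sumr n (c : 'I_n -> R[i]) (e : 'I_n -> H) (p : pred 'I_n) w :
  ip w (\sum_(i | p i) c i *: e i) = \sum_(i | p i) conjc (c i) * ip w (e i).
Proof. by rewrite linear_sumr; apply: eq_bigr => i _ /=; rewrite ipZr. Qed.

(** The family [v] may be dependent, so [k] need not be [n]; a vector with zero
    residual [w] adds nothing to the orthonormal family. *)
Lemma gram_schmidt V n (v : 'I_n -> H) : is_subspace V -> (forall i, V (v i)) ->
  exists k (e : 'I_k -> H), [/\ forall i j, ip (e i) (e j) = (i == j)%:R,
    forall i, V (e i) & forall i, v i = \sum_j ip (v i) (e j) *: e j].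
Proof.
move=> Vs; elim: n v => [|n IH] v Vv.
  by exists 0%N, (fun=> 0); split => [[]|[]|[]].
have [k [e [e1 Ve ve]]] := IH (fun i => v (lift ord0 i)) (fun i => Vv _).
pose w := v ord0 - \sum_j ip (v ord0) (e j) *: e j.
have Vw : V w.
  by apply: subspaceB => //; apply: subspace_sum => // i; exact: subspaceZ.
have we i : ip w (e i) = 0.
  rewrite linearBl /= ip_suml (bigD1 i) //= big1; last first.
    by move=> j ji; rewrite e1 (negPf ji) mulr0.
  by rewrite e1 eqxx mulr1 addr0 subrr.
have [w0|w0] := eqVneq w 0.
  exists k, e; split => // i; case: (unliftP ord0 i) => [j ->|->]; first exact: ve.
  by apply/eqP; rewrite -subr_eq0 -/w w0.
have nw : nrm w != 0 by apply: contra_neq w0; exact: nrm_eq0.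
pose e' (i : 'I_k.+1) := if unlift ord0 i is Some j then e j else (nrm w)^-1%:C *: w.
have e'0 : e' ord0 = (nrm w)^-1%:C *: w by rewrite /e' unlift_none.
have e'S j : e' (lift ord0 j) = e j by rewrite /e' liftK.
have we' : ip w (e' ord0) *: e' ord0 = w.
  rewrite e'0 ipZr scalerA ip_nrm conjc_real -!rmorphM /=.
  by rewrite expr2 mulKf // divff // scale1r.
exists k.+1, e'; split.
- move=> i j; case: (unliftP ord0 i) => [i' ->|->]; case: (unliftP ord0 j) => [j' ->|->].
  + by rewrite !e'S e1 (inj_eq lift_inj).
  + by rewrite e'S e'0 ipZr /= (ipC _ w) we conjc0 mulr0.
  + by rewrite e'S e'0 ipZl /= we mulr0.
  + rewrite e'0 ipZr ipZl ip_nrm conjc_real eqxx -!rmorphM.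
    by rewrite expr2 mulKf // mulVf.
- by move=> i; rewrite /e'; case: unlift => // ; exact: subspaceZ.
- move=> i; rewrite big_ord_recl; case: (unliftP ord0 i) => [j ->|->].
  + rewrite e'0 ipZr /=; have -> : ip (v (lift ord0 j)) w = 0.
      rewrite (ve j) ip_suml big1 // => l _.
      by rewrite (ipC _ w) we conjc0 mulr0.
    rewrite mulr0 scale0r add0r {1}(ve j).
    by apply: eq_bigr => l _; rewrite e'S.
  + have -> : ip (v ord0) (e' ord0) = ip w (e' ord0).
      rewrite [RHS]linearBl /= ip_suml big1 ?subr0 // => j _.
      by rewrite e'0 ipZr (ipC _ w) we conjc0 !mulr0.
    rewrite we'; under eq_bigr do rewrite e'S.
    by rewrite /w subrK.
Qed.

Lemma orthonormal_basis_exists V : is_subspace V -> finite_dim V ->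
  exists k (e : 'I_k -> H), orthonormal_basis V e.
Proof.
move=> Vs [n [v Vv]].
have Vvi i : V (v i).
  rewrite Vv; exists 1%N, (fun=> 1), (fun=> v i); split; first by move=> _; exists i.
  by rewrite big_ord1 scale1r.
have [k [e [e1 Ve ve]]] := gram_schmidt Vs Vvi.
exists k, e; split => // u; rewrite {1}Vv => -[p [c [s [hs ->]]]].
have se i : s i = \sum_j ip (s i) (e j) *: e j by have [j _ <-] := hs i; exact: ve.
transitivity (\sum_(i < p) \sum_j (c i * ip (s i) (e j)) *: e j).
  apply: eq_bigr => i _; rewrite {1}(se i) scaler_sumr.
  by apply: eq_bigr => j _; rewrite scalerA.
rewrite exchange_big; apply: eq_bigr => j _.
by rewrite -scaler_suml ip_suml.
Qed.

Lemma linear_op_sum T n (c : 'I_n -> R[i]) (e : 'I_n -> H) :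
  linear_op T -> (forall i, odom T (e i)) ->
  T (\sum_i c i *: e i) = \sum_i c i *: T (e i).
Proof.
move=> [Ts Tl] De.
have T0 : T 0 = 0.
  have := Tl 1 0 0 Ts.1 Ts.1; rewrite !scale1r addr0.
  by move=> /(congr1 (fun x => x - T 0)); rewrite addrK subrr.
pose Pr (x y : H) := odom T x /\ T x = y.
suff [] : Pr (\sum_i c i *: e i) (\sum_i c i *: T (e i)) by [].
apply: (big_ind2 Pr).
- by case: Ts.
- move=> x1 x2 y1 y2 [Dx <-] [Dy <-]; rewrite -[x1]scale1r; split.
    exact: Ts.2.
  by rewrite Tl // !scale1r.
- move=> i _; split; first exact: subspaceZ.
  by rewrite -[c i *: e i]addr0 Tl //; [rewrite T0 addr0|exact: Ts.1].
Qed.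

Lemma unitary_orthonormal_basis V k (e : 'I_k -> H) (P : 'M[R[i]]_k) :
  is_subspace V -> orthonormal_basis V e -> P \is unitarymx ->
  orthonormal_basis V (fun i => \sum_j P i j *: e j).
Proof.
move=> Vs [e1 Ve ve] PU.
have PP i j : \sum_l P i l * conjc (P j l) = (i == j)%:R.
  have /unitarymxP/matrixP/(_ i j) := PU; rewrite !mxE => <-.
  by apply: eq_bigr => l _; rewrite !mxE.
have PP' i j : \sum_l conjc (P l i) * P l j = (i == j)%:R.
  have /unitarymxP/mulmx1C/matrixP/(_ i j) := PU; rewrite !mxE => <-.
  by apply: eq_bigr => l _; rewrite !mxE.
split.
- move=> i j; rewrite ip_suml -PP; apply: eq_bigr => l _; congr (_ * _).
  rewrite ip_sumr (bigD1 l) //= e1 eqxx mulr1 big1 ?addr0 // => l' l'l.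
  by rewrite e1 eq_sym (negPf l'l) mulr0.
- by move=> i; apply: subspace_sum => // j; exact: subspaceZ.
- move=> u Vu; rewrite {1}(ve u Vu).
  transitivity (\sum_j \sum_l ((\sum_i conjc (P i j) * P i l) * ip u (e j)) *: e l).
    apply: eq_bigr => j _; rewrite (bigD1 j) //= PP' eqxx mul1r big1 ?addr0 // => l lj.
    by rewrite PP' eq_sym (negPf lj) mul0r scale0r.
  rewrite exchange_big /=.
  transitivity (\sum_l (\sum_i ip u (\sum_j P i j *: e j) * P i l) *: e l).
    apply: eq_bigr => l _; rewrite -scaler_suml; congr (_ *: _).
    under eq_bigr => j _ do rewrite mulr_suml.
    rewrite exchange_big; apply: eq_bigr => i _; rewrite ip_sumr mulr_suml.
    by apply: eq_bigr => j _; ring.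
  under [RHS]eq_bigr => i _ do rewrite scaler_sumr.
  rewrite [RHS]exchange_big; apply: eq_bigr => l _; rewrite scaler_suml.
  by apply: eq_bigr => i _; rewrite scalerA.
Qed.

Section Eigenbasis.
Variables (q : sform R H) (hq : hermitian_form q) (V : set H) (T : operator H).
Hypotheses (Vq : V `<=` fdom q) (Vfin : finite_dim V) (VT : galerkin_op ip q V T).

Lemma galerkin_subspace : is_subspace V.
Proof. by case: VT => -[+ _] + _ _ => /[swap] ->. Qed.

(** The matrix of [T] in an orthonormal basis is Hermitian, and the unitary
    matrix diagonalizing it turns that basis into one of eigenvectors. *)
Lemma galerkin_eigenbasis : exists k (f : 'I_k -> H) (lam : 'I_k -> R),
  orthonormal_basis V f /\ forall i, T (f i) = (lam i)%:C *: f i.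
Proof.
have Vs := galerkin_subspace.
have [k [e eB]] := orthonormal_basis_exists Vs Vfin; have [e1 Ve ve] := eB.
case: VT => Tlin TV TV' Tq.
pose M : 'M[R[i]]_k := \matrix_(i, j) ip (T (e i)) (e j).
have Mherm : M \is hermsymmx.
  apply/is_hermitianmxP; rewrite expr0 scale1r; apply/matrixP => i j; rewrite !mxE.
  by rewrite !Tq // (formC hq) //; exact: Vq.
have /orthomx_spectralP := hermitian_normalmx Mherm.
set P := spectralmx M; set d := spectral_diag M => EM.
have PU : P \is unitarymx := spectral_unitarymx M.
have PM : P *m M = diag_mx d *m P.
  by rewrite EM !mulmxA mulmxV ?mul1mx // unitarymx_unit.
pose f i := \sum_j P i j *: e j.
have fB : orthonormal_basis V f := unitary_orthonormal_basis Vs eB PU.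
have Tf i : T (f i) = d 0 i *: f i.
  rewrite /f linear_op_sum //; last by move=> j; rewrite TV.
  transitivity (\sum_l (P *m M) i l *: e l).
    under [RHS]eq_bigr => l _ do rewrite mxE scaler_suml.
    rewrite [RHS]exchange_big; apply: eq_bigr => j _; rewrite {1}(ve _ (TV' _ (Ve j))).
    by rewrite scaler_sumr; apply: eq_bigr => l _; rewrite mxE scalerA.
  rewrite PM scaler_sumr; apply: eq_bigr => l _.
  by rewrite mul_diag_mx mxE scalerA.
exists k, f, (fun i => complex.Re (d 0 i)); split => // i.
rewrite Tf; congr (_ *: _).
have [f1 Vf _] := fB.
have := form_Im hq (Vq (Vf i)); rewrite -Tq // Tf ipZl /= f1 eqxx mulr1.
by case: (d 0 i) => x y /= ->.
Qed.
End Eigenbasis.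
End FiniteDim.

(** * Galerkin spectral projections *)

Section GalerkinProjection.
Context {R : realType} {H : completeNormedModType R[i]}.
Variable ip : {dot H for @Num.conj R[i]}.
Implicit Types (V : set H) (q : sform R H) (T : operator H).
Local Notation nrm := (seminorm (ip_form ip)).

Section OrthProj.
Variables (V : set H) (Q : H -> H) (hQ : orth_proj ip V Q).

Lemma orth_proj_uniq u x : V x -> (forall v, V v -> ip (u - x) v = 0) -> Q u = x.
Proof.
move=> Vx ux; have [VQ uQ] := hQ u.
apply/eqP; rewrite -subr_eq0; apply/eqP/(@nrm_eq0 _ _ ip).
have xQ v : V v -> ip (Q u - x) v = 0.
  move=> Vv; have -> : Q u - x = (u - x) - (u - Q u).
    by rewrite opprB [RHS]addrC subrKA.
  by rewrite linearBl /= ux // uQ // subrr.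
apply/eqP; rewrite -sqrf_eq0 -Re_ip linearBr /=.
by rewrite !xQ // subrr.
Qed.

Lemma orth_proj_pythagoras u : nrm u ^+ 2 = nrm (Q u) ^+ 2 + nrm (u - Q u) ^+ 2.
Proof.
have [VQ uQ] := hQ u.
have {1}-> : u = Q u + (u - Q u) by rewrite [RHS]addrC subrK.
rewrite nrm_pythagoras //; by rewrite ipC uQ // conjc0.
Qed.

Lemma nrm_orth_proj u : nrm (Q u) <= nrm u.
Proof.
rewrite -ler_sqr ?nnegrE ?seminorm_ge0 // (orth_proj_pythagoras u).
by rewrite lerDl sqr_ge0.
Qed.

Lemma nrm_orth_projC u : nrm (u - Q u) <= nrm u.
Proof.
rewrite -ler_sqr ?nnegrE ?seminorm_ge0 // (orth_proj_pythagoras u).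
by rewrite lerDr sqr_ge0.
Qed.

End OrthProj.

(** The squared modulus, as an element of [R]. *)
Definition sqc (z : R[i]) : R := complex.Re z ^+ 2 + complex.Im z ^+ 2.

Lemma sqc_ge0 z : 0 <= sqc z. Proof. by rewrite addr_ge0 ?sqr_ge0. Qed.

Lemma Re_sum n (p : pred 'I_n) (F : 'I_n -> R[i]) :
  complex.Re (\sum_(i | p i) F i) = \sum_(i | p i) complex.Re (F i).
Proof. exact: (raddf_sum (@complex.Re R : Rcomplex R -> R)). Qed.

Lemma sqcM x y : sqc (x * y) = sqc x * sqc y.
Proof. by case: x y => ? ? [? ?]; rewrite /sqc /=; ring. Qed.

Section Basis.
Variables (V : set H) (k : nat) (f : 'I_k -> H) (fB : orthonormal_basis ip V f).
Implicit Types p : pred 'I_k.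

Definition basis_proj p u := \sum_(i | p i) ip u (f i) *: f i.

Lemma ip_sum_basis p (c : 'I_k -> R[i]) j :
  ip (\sum_(i | p i) c i *: f i) (f j) = if p j then c j else 0.
Proof.
have [f1 _ _] := fB; rewrite ip_suml; case: ifPn => pj.
  rewrite (bigD1 j) //= f1 eqxx mulr1 big1 ?addr0 // => i /andP[_ ij].
  by rewrite f1 (negPf ij) mulr0.
rewrite big1 // => i pi; rewrite f1 [i == j](_ : _ = false) ?mulr0 //.
by apply: contraNF pj => /eqP <-.
Qed.

Lemma ip_sum_sum p (c d : 'I_k -> R[i]) :
  ip (\sum_(i | p i) c i *: f i) (\sum_(i | p i) d i *: f i) =
  \sum_(i | p i) c i * conjc (d i).
Proof.
rewrite ip_sumr; apply: eq_bigr => i pi.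
by rewrite ip_sum_basis pi mulrC.
Qed.

Lemma sqr_nrm_sum p (c : 'I_k -> R[i]) :
  nrm (\sum_(i | p i) c i *: f i) ^+ 2 = \sum_(i | p i) sqc (c i).
Proof.
rewrite -Re_ip ip_sum_sum Re_sum.
by apply: eq_bigr => i _; case: (c i) => x y; rewrite /sqc /=; ring.
Qed.

Lemma basis_proj_orth p u j : p j -> ip (u - basis_proj p u) (f j) = 0.
Proof. by move=> pj; rewrite linearBl /= ip_sum_basis pj subrr. Qed.

Lemma bessel p u : \sum_(i | p i) sqc (ip u (f i)) <= nrm u ^+ 2.
Proof.
rewrite -sqr_nrm_sum -/(basis_proj p u).
have -> : nrm u ^+ 2 = nrm (basis_proj p u) ^+ 2 + nrm (u - basis_proj p u) ^+ 2.
  have {1}-> : u = basis_proj p u + (u - basis_proj p u) by rewrite [RHS]addrC subrK.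
  rewrite nrm_pythagoras //.
  rewrite ip_suml big1 // => i pi; rewrite (ipC ip (u - basis_proj p u)).
  by rewrite basis_proj_orth // conjc0 mulr0.
by rewrite lerDl sqr_ge0.
Qed.

End Basis.

Section Galerkin.
Variables (q : sform R H) (hq : hermitian_form q) (V : set H) (T : operator H).
Hypotheses (Vq : V `<=` fdom q) (Vfin : finite_dim V) (VT : galerkin_op ip q V T).
Variables (a b : R) (ltab : a < b) (Q : H -> H).
Hypothesis hQ : orth_proj ip (eigen_span T `[a, b]%classic) Q.

Section FixedBasis.
Variables (k : nat) (f : 'I_k -> H) (lam : 'I_k -> R).
Hypotheses (fB : orthonormal_basis ip V f) (Tf : forall i, T (f i) = (lam i)%:C *: f i).
Let Vs := galerkin_subspace VT.
Let f1 := let: And3 h _ _ := fB in h.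
Let Vf := let: And3 _ h _ := fB in h.
Let Vexp := let: And3 _ _ h := fB in h.

Definition in_window : pred 'I_k := fun i => a <= lam i <= b.

(** Eigenvectors for different eigenvalues are orthogonal, so an eigenvector
    with eigenvalue in the window has no component outside it. *)
Lemma eigenspace_sub s x : a <= x <= b -> Defs.eigenspace T x%:C s ->
  s = basis_proj f in_window s.
Proof.
case: VT => Tlin TV TV' Tq xab [Vs' Ts']; rewrite TV in Vs'.
rewrite {1}(Vexp Vs') (bigID in_window) /= [X in _ + X]big1 ?addr0 // => i iab.
suff -> : ip s (f i) = 0 by rewrite scale0r.
have : x%:C * ip s (f i) = (lam i)%:C * ip s (f i).
  rewrite -ipZl -Ts' -[RHS](_ : ip s (T (f i)) = _); last by rewrite Tf ipZr conjc_real.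
  rewrite Tq // (formC hq (Vq (Vf i)) (Vq Vs')) -Tq // -ipC //.
move/eqP; rewrite -subr_eq0 -mulrBl mulf_eq0 => /predU1P[|/eqP//].
rewrite -rmorphB => /(congr1 (@complex.Re R)) /= /eqP; rewrite subr_eq0 => /eqP xl.
by move: iab; rewrite /in_window -xl xab.
Qed.

Lemma eigen_span_proj u : Q u = basis_proj f in_window u.
Proof.
case: VT => Tlin TV TV' Tq.
apply: (orth_proj_uniq hQ).
  exists #|[pred i | in_window i]|, (fun j => ip u (f (enum_val j))),
    (fun j => f (enum_val j)).
  split; last first.
    exact: (big_enum_val (A := [pred i | in_window i]) (fun i => ip u (f i) *: f i)).
  move=> j; split.
    apply/eqP => fj0; have := f1 (enum_val j) (enum_val j).
    by rewrite fj0 linear0l eqxx => /esym/eqP; rewrite oner_eq0.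
  exists (lam (enum_val j)); last by split; [rewrite TV|].
  by have := enum_valP j; rewrite inE /in_window /= in_itv.
move=> v [n [c [s [hs ->]]]].
rewrite ip_sumr big1 // => j _; have [_ [x xab es]] := hs j.
rewrite (eigenspace_sub _ es); last by move: xab; rewrite /= in_itv.
rewrite ip_sumr big1 ?mulr0 // => i iab.
by rewrite (basis_proj_orth fB) // mulr0.
Qed.

Lemma basis_sub p c : V (\sum_(i | p i) c i *: f i).
Proof. by apply: subspace_sum => // i; exact: subspaceZ. Qed.

Lemma form_sum_basis p c v : V v ->
  q (\sum_(i | p i) c i *: f i) v = \sum_(i | p i) c i * (lam i)%:C * ip (f i) v.
Proof.
move=> Vv; case: VT => Tlin TV TV' Tq.
have -> : \sum_(i | p i) c i *: f i = \sum_i (if p i then c i else 0) *: f i.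
  rewrite [RHS](bigID p) /= [X in _ + X]big1 ?addr0; last first.
    by move=> i /negPf ->; rewrite scale0r.
  by apply: eq_bigr => i ->.
rewrite -Tq //; last exact: basis_sub.
rewrite linear_op_sum //; last by move=> i; rewrite TV.
rewrite ip_suml [LHS](bigID p) /= [X in _ + X]big1 ?addr0; last first.
  by move=> i /negPf ->; rewrite mul0r.
by apply: eq_bigr => i ->; rewrite Tf ipZl mulrA.
Qed.

End FixedBasis.

(** In the eigenbasis the Galerkin resolvent divides the coefficient of [f i] by
    [lam i - z], and [|lam i - z| <= rho] if and only if [a <= lam i <= b]. *)
Lemma galerkin_resolvent (c eta rho : R) : c = (a + b) / 2 -> 0 < eta -> 0 < rho ->
    rho ^+ 2 = ((b - a) / 2) ^+ 2 + eta ^+ 2 ->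
  exists G : H -> H, forall w,
  [/\ V (G w),
      forall v, V v -> q (G w) v - (c +i* eta) * ip (G w) v = ip w v,
      nrm (Q w) <= rho * nrm (Q (G w)) &
      rho * nrm (G w - Q (G w)) <= nrm (w - Q w)].
Proof.
move=> cE eta0 rho0 rhoE.
have [k [f [lam [fB Tf]]]] := galerkin_eigenbasis hq Vq Vfin VT.
have [f1 Vf Vexp] := fB; have rho0' := ltW rho0.
pose z := c +i* eta.
have z0 i : (lam i)%:C - z != 0.
  apply/eqP => /(congr1 (@complex.Im R)) /= /eqP.
  by rewrite sub0r oppr_eq0 gt_eqF.
pose g w i := ip w (f i) / ((lam i)%:C - z).
pose G w := \sum_i g w i *: f i.
have gE w i : ip (G w) (f i) = g w i by rewrite (ip_sum_basis fB).
have sqcE w i : sqc (ip w (f i)) = ((lam i - c) ^+ 2 + eta ^+ 2) * sqc (g w i).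
  rewrite -[ip w _](divfK (z0 i)) sqcM mulrC; congr (_ * _).
  by rewrite /sqc /= sub0r sqrrN.
have QE := eigen_span_proj fB Tf.
pose W := in_window lam.
have inW i : W i -> (lam i - c) ^+ 2 + eta ^+ 2 <= rho ^+ 2.
  move=> /andP[al lb]; rewrite rhoE lerD2r cE.
  have : 0 <= (lam i - a) * (b - lam i) by rewrite mulr_ge0 ?subr_ge0.
  by lra.
have outW i : ~~ W i -> rho ^+ 2 <= (lam i - c) ^+ 2 + eta ^+ 2.
  move=> Wi; rewrite rhoE lerD2r cE.
  have : 0 <= (lam i - a) * (lam i - b).
    move: Wi; rewrite /W /in_window negb_and -!ltNge => /orP[la|bl].
      by rewrite mulr_le0 // subr_le0 ltW // (lt_trans la).
    by rewrite mulr_ge0 // subr_ge0 ltW // (lt_trans ltab).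
  by lra.
exists G => w; split.
- exact: (basis_sub fB).
- move=> v Vv; rewrite (form_sum_basis fB Tf) // ip_suml mulr_sumr -sumrB.
  rewrite [in RHS](Vexp v Vv) ip_sumr; apply: eq_bigr => i _.
  rewrite (ipC ip (f i) v) conjcK /g -/z.
  by field; exact: z0.
- rewrite -ler_sqr ?nnegrE ?mulr_ge0 ?seminorm_ge0 // exprMn !QE.
  rewrite !(sqr_nrm_sum fB) mulr_sumr; apply: ler_sum => i Wi.
  by rewrite gE sqcE ler_wpM2r ?sqc_ge0 ?inW.
- rewrite -ler_sqr ?nnegrE ?mulr_ge0 ?seminorm_ge0 // exprMn !QE.
  have -> : G w - basis_proj f W (G w) = \sum_(i | ~~ W i) g w i *: f i.
    rewrite /G /basis_proj [X in X - _](bigID W) /=.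
    under [X in _ - X]eq_bigr => i _ do rewrite gE.
    by rewrite addrAC subrr add0r.
  rewrite (sqr_nrm_sum fB) mulr_sumr.
  apply: le_trans (bessel fB (predC W) _); apply: ler_sum => i Wi.
  rewrite linearBl /= (ip_sum_basis fB) -/W (negPf Wi) subr0 sqcE.
  by rewrite ler_wpM2r ?sqc_ge0 ?outW.
Qed.

Lemma galerkin_proj_sub w : V (Q w).
Proof.
have [k [f [lam [fB Tf]]]] := galerkin_eigenbasis hq Vq Vfin VT.
by rewrite (eigen_span_proj fB Tf); exact: (basis_sub fB).
Qed.

Lemma galerkin_proj_lin c u v : Q (c *: u + v) = c *: Q u + Q v.
Proof.
have [k [f [lam [fB Tf]]]] := galerkin_eigenbasis hq Vq Vfin VT.
rewrite !(eigen_span_proj fB Tf) scaler_sumr -big_split; apply: eq_bigr => i _ /=.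
by rewrite linearPl scalerDl scalerA.
Qed.

Lemma galerkin_projZ c u : Q (c *: u) = c *: Q u.
Proof.
have Q0 : Q 0 = 0.
  have := galerkin_proj_lin 1 0 0; rewrite !scale1r addr0.
  by move=> /(congr1 (fun x => x - Q 0)); rewrite addrK subrr.
by rewrite -[c *: u]addr0 galerkin_proj_lin Q0 addr0.
Qed.

Lemma galerkin_projB u v : Q (u - v) = Q u - Q v.
Proof. by rewrite addrC -scaleN1r galerkin_proj_lin scaleN1r addrC. Qed.

Lemma galerkin_proj_form_le w : complex.Re (q (Q w) (Q w)) <= b * nrm (Q w) ^+ 2.
Proof.
have [k [f [lam [fB Tf]]]] := galerkin_eigenbasis hq Vq Vfin VT.
rewrite {1}(eigen_span_proj fB Tf) (form_sum_basis fB Tf); last exact: galerkin_proj_sub.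
rewrite !(eigen_span_proj fB Tf) (sqr_nrm_sum fB) mulr_sumr.
rewrite Re_sum; apply: ler_sum => i Wi.
rewrite (ipC ip _ (f i)) (ip_sum_basis fB) Wi.
have /andP[_ lb] := Wi.
have -> : complex.Re (ip w (f i) * (lam i)%:C * conjc (ip w (f i))) =
   lam i * sqc (ip w (f i)).
  by case: (ip w (f i)) => x y; rewrite /sqc /=; ring.
by rewrite ler_wpM2r ?sqc_ge0.
Qed.

(** The range of [Q] and its complement in [V] are spanned by different
    eigenvectors, hence they are orthogonal for the form as well. *)
Lemma galerkin_proj_form_orth w v : V v -> q (Q w) (v - Q v) = 0.
Proof.
move=> Vv.
have [k [f [lam [fB Tf]]]] := galerkin_eigenbasis hq Vq Vfin VT.
have Vs := galerkin_subspace VT.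
have VvQ : V (v - Q v) by apply: subspaceB => //; exact: galerkin_proj_sub.
rewrite (eigen_span_proj fB Tf w) (form_sum_basis fB Tf) // big1 // => i Wi.
rewrite (eigen_span_proj fB Tf) (ipC ip (v - basis_proj f (in_window lam) v)).
by rewrite (basis_proj_orth fB) // conjc0 mulr0.
Qed.

End Galerkin.
End GalerkinProjection.

(** * Moments of measures on the real line *)

Section Moments.
Context {R : realType}.
Local Notation RT := (measurableTypeR R).
Implicit Types (nu : {measure set RT -> \bar R}) (B : set RT).

Definition first_moment nu : \bar R := \int[nu]_x x%:E.
Definition second_moment nu : \bar R := \int[nu]_x (x ^+ 2)%:E.

Lemma measurable_id_EFin (D : set RT) : measurable_fun D (fun x : RT => (x : R)%:E).
Proof. by apply/measurable_EFinP; exact: measurable_id. Qed.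

Lemma measurable_sqr_EFin (D : set RT) : measurable_fun D (fun x : RT => ((x : R) ^+ 2)%:E).
Proof. by apply/measurable_EFinP; apply: measurable_funX; exact: measurable_id. Qed.

Lemma integrable_cst_finite nu B (c : R) : measurable B ->
  (nu setT < +oo)%E -> nu.-integrable B (fun=> c%:E).
Proof.
move=> mB nuT; apply/integrableP; split; first exact: measurable_cst.
rewrite [ltLHS](_ : _ = \int[nu]_(x in B) cst `|c|%:E x)%E // integral_cst //.
have nuB : (nu B < +oo)%E by apply: le_lt_trans nuT; apply: le_measure => //; rewrite inE.
by rewrite lte_mul_pinfty // lee_fin.
Qed.

(** By [|x| <= 1 + x ^ 2]. *)
Lemma integrable_first_moment nu : (nu setT < +oo)%E ->
  (second_moment nu < +oo)%E -> nu.-integrable setT (fun x : RT => (x : R)%:E).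
Proof.
move=> nuT nu2.
apply: (@le_integrable _ _ _ _ _ _ _ (fun x : RT => 1%:E + ((x : R) ^+ 2)%:E)%E) => //.
- exact: measurable_id_EFin.
- move=> x _; rewrite -EFinD /= lee_fin [leRHS]ger0_norm ?addr_ge0 ?sqr_ge0 //.
  rewrite -[x ^+ 2]real_normK ?num_real //.
  by have := sqr_ge0 (`|x| - 1); have := normr_ge0 x; nra.
apply: integrableD => //; first exact: integrable_cst_finite.
apply/integrableP; split; first exact: measurable_sqr_EFin.
apply: le_lt_trans nu2; rewrite le_eqVlt; apply/orP; left; apply/eqP.
by apply: eq_integral => x _ /=; rewrite ger0_norm ?sqr_ge0.
Qed.

Lemma first_moment_le nu B (h : R) : measurable B -> (nu setT < +oo)%E ->
  (second_moment nu < +oo)%E -> nu (~` B) = 0%E -> (forall x, B x -> x <= h) ->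
  (first_moment nu <= h%:E * nu B)%E.
Proof.
move=> mB nuT nu2 nuB Bh; have nui := integrable_first_moment nuT nu2.
rewrite /first_moment (negligible_integral (measurableC mB)) // setDE setTI setCK.
rewrite -integral_cst //; apply: le_integral => //.
- exact: (integrableS measurableT).
- exact: integrable_cst_finite.
- by move=> x /set_mem Bx; rewrite lee_fin; exact: Bh.
Qed.

Lemma first_moment_ge nu B (l : R) : measurable B -> (nu setT < +oo)%E ->
  (second_moment nu < +oo)%E -> nu (~` B) = 0%E -> (forall x, B x -> l <= x) ->
  (l%:E * nu B <= first_moment nu)%E.
Proof.
move=> mB nuT nu2 nuB Bh; have nui := integrable_first_moment nuT nu2.
rewrite /first_moment (negligible_integral (measurableC mB)) // setDE setTI setCK.
rewrite -integral_cst //; apply: le_integral => //.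
- exact: integrable_cst_finite.
- exact: (integrableS measurableT).
- by move=> x /set_mem Bx; rewrite lee_fin; exact: Bh.
Qed.

Lemma second_moment_bounded nu B (M : R) : measurable B -> (nu setT < +oo)%E ->
  nu (~` B) = 0%E -> (forall x, B x -> `|x| <= M) -> (second_moment nu < +oo)%E.
Proof.
move=> mB nuT nuB BM.
apply: (@le_lt_trans _ _ (\int[nu]_x cst (M ^+ 2)%:E x)%E); last first.
  by rewrite integral_cst // lte_mul_pinfty // lee_fin sqr_ge0.
apply: ae_ge0_le_integral => //.
- by move=> x _; rewrite lee_fin sqr_ge0.
- exact: measurable_sqr_EFin.
- by move=> x _; rewrite lee_fin sqr_ge0.
- exists (~` B); split => //; first exact: measurableC.
  move=> x /= + Bx; apply => _; rewrite lee_fin -real_normK ?num_real //.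
  by rewrite ler_sqr ?nnegrE ?(le_trans _ (BM x Bx)) ?BM.
Qed.

Lemma second_moment_add nu nu1 nu2 :
  (forall B, measurable B -> nu B = (nu1 B + nu2 B)%E) ->
  second_moment nu = (second_moment nu1 + second_moment nu2)%E.
Proof.
move=> E; rewrite /second_moment -ge0_integral_measure_add //.
- by apply: eq_measure_integral => B mB _; rewrite E //; exact/esym/measure_addE.
- by move=> x _; rewrite lee_fin sqr_ge0.
- exact: measurable_sqr_EFin.
Qed.

Lemma first_moment_add nu nu1 nu2 :
  (forall B, measurable B -> nu B = (nu1 B + nu2 B)%E) ->
  (nu1 setT < +oo)%E -> (nu2 setT < +oo)%E ->
  (second_moment nu1 < +oo)%E -> (second_moment nu2 < +oo)%E ->
  first_moment nu = (first_moment nu1 + first_moment nu2)%E.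
Proof.
move=> E f1 f2 s1 s2; rewrite /first_moment -integral_measure_add //.
- by apply: eq_measure_integral => B mB _; rewrite E //; exact/esym/measure_addE.
- exact: integrable_first_moment.
- exact: integrable_first_moment.
Qed.

End Moments.

(** * Spectral subspaces of a self-adjoint operator *)

Section Spectral.
Context {R : realType} {H : completeNormedModType R[i]}.
Variable ip : {dot H for @Num.conj R[i]}.
Hypothesis hip : norm_from_ip ip.
Local Notation nrm := (seminorm (ip_form ip)).
Local Notation RT := (measurableTypeR R).

Lemma ip_ext u v : (forall w, ip u w = ip v w) -> u = v.
Proof.
move=> uv; apply/eqP; rewrite -subr_eq0; apply/eqP/(@nrm_eq0 _ _ ip)/eqP.
by rewrite -sqrf_eq0 -Re_ip linearBl /= uv subrr.
Qed.

Section SelfAdjoint.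
Variables (A : operator H) (A_sa : self_adjoint ip A).

Lemma odom_subspace : is_subspace (odom A). Proof. by case: A_sa => -[]. Qed.

Lemma odom_lin c u v : odom A u -> odom A v -> odom A (c *: u + v).
Proof. exact: odom_subspace.2. Qed.

Lemma odomD u v : odom A u -> odom A v -> odom A (u + v).
Proof. by rewrite -{2}[u]scale1r; exact: odom_lin. Qed.

Lemma odomZ c u : odom A u -> odom A (c *: u).
Proof. by move=> Du; rewrite -[_ *: _]addr0; apply: odom_lin => //; exact: odom_subspace.1. Qed.

Lemma oapp_lin c u v : odom A u -> odom A v -> A (c *: u + v) = c *: A u + A v.
Proof. by case: A_sa => -[_ +] _ _; apply. Qed.

Lemma oapp0 : A 0 = 0.
Proof.
have D0 := odom_subspace.1.
have := oapp_lin 1 D0 D0; rewrite !scale1r addr0.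
by move=> /(congr1 (fun x => x - A 0)); rewrite addrK subrr.
Qed.

Lemma oappD u v : odom A u -> odom A v -> A (u + v) = A u + A v.
Proof. by move=> Du Dv; have := oapp_lin 1 Du Dv; rewrite !scale1r. Qed.

Lemma self_adjoint_sym u v : odom A u -> odom A v -> ip (A u) v = ip u (A v).
Proof.
move=> Du Dv; case: A_sa => _ _ /(_ v (A v))[_ /(_ (conj Dv erefl))].
by apply.
Qed.

Lemma adjoint_graph0 w : adjoint_graph ip A 0 w -> w = 0.
Proof. by case: A_sa => _ _ /(_ 0 w)[+ _] => /[apply] -[_ ->]; exact: oapp0. Qed.

(** [A - c] is symmetric, so the cross term is purely imaginary. *)
Lemma nrm_shift_complex (c eta : R) x : odom A x ->
  nrm (A x - (c +i* eta) *: x) ^+ 2 =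
  nrm (A x - c%:C *: x) ^+ 2 + eta ^+ 2 * nrm x ^+ 2.
Proof.
move=> Dx.
have rAx : complex.Im (ip (A x) x) = 0.
  have := self_adjoint_sym Dx Dx; rewrite (ipC ip (A x) x).
  case: (ip (A x) x) => s t /= [] /eqP.
  by rewrite -addr_eq0 -mulr2n mulrn_eq0 /= => /eqP.
have -> : A x - (c +i* eta) *: x = (A x - c%:C *: x) + (0 -i* eta) *: x.
  have -> : 0 -i* eta = c%:C - (c +i* eta) by congr Complex; rewrite /= ?subrr ?add0r.
  by rewrite scalerBl addrA subrK.
rewrite -!Re_ip (form_ReD (ip_form_psd ip).1) // (form_ReZ (ip_form_psd ip).1) //=.
rewrite ipZr (_ : ip (A x - c%:C *: x) x = ip (A x) x - c%:C * ip x x); last first.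
  by rewrite linearBl /= ipZl.
rewrite (ip_nrm ip x) /=; case: (ip (A x) x) rAx => s t /= ->.
by ring.
Qed.

(** On an invariant subspace of the domain a bound on the quadratic form of
    [A - c] is a bound on its norm: with [y = (A - c) x] and [s = 1 / r], subtract
    the values of the form at [s y + x] and at [- s y + x].  The difference is
    [4 s |y| ^ 2] and, by the parallelogram law, at most
    [2 r (s ^ 2 |y| ^ 2 + |x| ^ 2)]. *)
Lemma self_adjoint_bound (W : set H) (c r : R) : 0 < r -> is_subspace W ->
  W `<=` odom A -> (forall x, W x -> W (A x)) ->
  (forall x, W x -> `|complex.Re (ip (A x) x) - c * nrm x ^+ 2| <= r * nrm x ^+ 2) ->
  forall x, W x -> nrm (A x - c%:C *: x) <= r * nrm x.
Proof.
move=> r0 Ws WD WA Wr x Wx.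
pose y := A x - c%:C *: x.
have Wy : W y by rewrite /y addrC -scaleNr; apply: Ws.2 => //; exact: WA.
have Ex : A x = y + c%:C *: x by rewrite /y subrK.
rewrite -/y; clearbody y.
pose s := r^-1.
have W1 : W (s%:C *: y + x) by exact: Ws.2.
have W2 : W ((- s)%:C *: y + x) by exact: Ws.2.
have E t : complex.Re (ip (A (t%:C *: y + x)) (t%:C *: y + x))
    - c * nrm (t%:C *: y + x) ^+ 2 =
  t ^+ 2 * (complex.Re (ip (A y) y) - c * nrm y ^+ 2) + 2 * t * nrm y ^+ 2
    + (complex.Re (ip (A x) x) - c * nrm x ^+ 2).
  rewrite (oapp_lin _ (WD _ Wy) (WD _ Wx)) -Re_ip !linearDl /= !linearDr /= !ipZl !ipZr.
  have -> : ip (A y) x = ip y (A x) by apply: self_adjoint_sym; exact: WD.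
  rewrite (_ : ip y (A x) = ip y y + c%:C * ip y x); last first.
    by rewrite Ex linearDr /= ipZr conjc_real.
  rewrite (_ : ip (A x) y = ip y y + c%:C * ip x y); last first.
    by rewrite Ex linearDl /= ipZl.
  rewrite (ipC ip x y) !ip_nrm /=.
  by case: (ip (A y) y) (ip (A x) x) (ip x y) => ? ? [? ?] [? ?] /=; ring.
have nE t : nrm (t%:C *: y + x) ^+ 2 =
    t ^+ 2 * nrm y ^+ 2 + 2 * t * complex.Re (ip y x) + nrm x ^+ 2.
  rewrite -!Re_ip (form_ReD (ip_form_psd ip).1) // (form_ReZ (ip_form_psd ip).1) //= ipZl.
  by case: (ip y x) => ? ? /=; ring.
have := Wr _ W1; have := Wr _ W2; rewrite !E !nE !ler_norml => /andP[h1 _] /andP[_ h2].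
rewrite -ler_sqr ?nnegrE ?mulr_ge0 ?seminorm_ge0 ?(ltW r0) //.
have rs : r * s = 1 by rewrite divff // gt_eqF.
have key : s * nrm y ^+ 2 <= r * nrm x ^+ 2.
  have s2 : r * (s ^+ 2 * nrm y ^+ 2) = s * nrm y ^+ 2 by rewrite expr2 !mulrA rs mul1r.
  by move: h1 h2; rewrite !mulrDr sqrrN s2; lra.
have -> : nrm y ^+ 2 = r * (s * nrm y ^+ 2) by rewrite mulrA rs mul1r.
by rewrite exprMn expr2 -mulrA ler_pM2l.
Qed.

End SelfAdjoint.

Section Pvm.
Variables (P : set R -> H -> H) (mu : H -> {measure set RT -> \bar R}).
Hypothesis Pmu : projection_valued_measure ip P mu.
Implicit Types B C : set RT.

Lemma pvm_idem B u : measurable B -> P B (P B u) = P B u.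
Proof. by case: Pmu => + _ _ _ mB => /(_ B mB)[+ _]; apply. Qed.

Lemma pvm_sym B u v : measurable B -> ip (P B u) v = ip u (P B v).
Proof. by case: Pmu => + _ _ _ mB => /(_ B mB)[_ +]; apply. Qed.

Lemma pvmT u : P setT u = u. Proof. by case: Pmu => _ + _ _; apply. Qed.

Lemma pvmI B C u : measurable B -> measurable C -> P (B `&` C) u = P B (P C u).
Proof. by case: Pmu => _ _ + _ mB mC; apply. Qed.

Lemma pvm_lin B c u v : measurable B -> P B (c *: u + v) = c *: P B u + P B v.
Proof.
move=> mB; apply: ip_ext => w; rewrite pvm_sym // !linearPl /=.
by rewrite -!pvm_sym.
Qed.

Lemma pvmD B u v : measurable B -> P B (u + v) = P B u + P B v.
Proof. by move=> mB; have := pvm_lin 1 u v mB; rewrite !scale1r. Qed.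

Lemma pvm_0 B : measurable B -> P B 0 = 0.
Proof.
move=> mB; apply: ip_ext => w; rewrite pvm_sym // !linear0l //.
Qed.

Lemma pvmZ B c u : measurable B -> P B (c *: u) = c *: P B u.
Proof. by move=> mB; have := pvm_lin c u 0 mB; rewrite pvm_0 // !addr0. Qed.

Lemma scalar_measureE u B : measurable B -> mu u B = (nrm (P B u) ^+ 2)%:E.
Proof.
by case: (Pmu) => _ _ _ muE mB; rewrite muE // -Re_ip -[in LHS]pvm_idem // pvm_sym.
Qed.

Lemma scalar_measureT u : mu u setT = (nrm u ^+ 2)%:E.
Proof. by rewrite scalar_measureE // pvmT. Qed.

Lemma scalar_measureT_lty u : (mu u setT < +oo)%E.
Proof. by rewrite scalar_measureT ltry. Qed.

Lemma pvm_set0 u : P set0 u = 0.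
Proof.
apply: (@nrm_eq0 _ _ ip); apply/eqP; rewrite -sqrf_eq0.
by have := scalar_measureE u measurable0; rewrite measure0 => -[<-].
Qed.

Lemma pvm_disjoint B C u : measurable B -> measurable C -> B `&` C = set0 ->
  P B (P C u) = 0.
Proof. by move=> mB mC BC; rewrite -pvmI // BC pvm_set0. Qed.

(** Finite additivity of the projections comes from that of the scalar
    measures, via Pythagoras. *)
Lemma pvm_compl B u : measurable B -> P B u + P (~` B) u = u.
Proof.
move=> mB; have mC := measurableC mB.
have ortho : ip (P B u) (P (~` B) u) = 0.
  by rewrite pvm_sym // pvm_disjoint ?setICr // linear0r.
have E : nrm u ^+ 2 = nrm (P B u) ^+ 2 + nrm (P (~` B) u) ^+ 2.
  apply: EFin_inj; rewrite EFinD -!scalar_measureE // -scalar_measureT.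
  by rewrite -measureU ?setICr // setUv.
apply/eqP; rewrite -subr_eq0; apply/eqP/(@nrm_eq0 _ _ ip)/eqP.
rewrite -sqrf_eq0 -Re_ip.
have p1 : ip (P B u) u = (nrm (P B u) ^+ 2)%:C by rewrite -ip_nrm -[in LHS]pvm_idem // pvm_sym.
have p2 : ip (P (~` B) u) u = (nrm (P (~` B) u) ^+ 2)%:C.
  by rewrite -ip_nrm -[in LHS]pvm_idem // pvm_sym.
rewrite !linearBl /= !linearBr /= !linearDl /= !linearDr /=.
rewrite ortho (ipC ip (P B u) (P (~` B) u)) ortho (ipC ip (P B u) u) (ipC ip (P (~` B) u) u).
rewrite p1 p2 !ip_nrm conjc0 !conjc_real E /=.
by apply/eqP; ring.
Qed.

Definition pvm_range B : set H := [set u | P B u = u].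

Lemma pvm_range_P B u : measurable B -> pvm_range B (P B u).
Proof. exact: pvm_idem. Qed.

Lemma pvm_range_subspace B : measurable B -> is_subspace (pvm_range B).
Proof.
move=> mB; split; first exact: pvm_0.
by move=> c u v hu hv; rewrite /pvm_range /= pvm_lin // hu hv.
Qed.

Lemma pvm_rangeS B C u : measurable B -> measurable C -> B `<=` C ->
  pvm_range B u -> pvm_range C u.
Proof.
by move=> mB mC /setIidr BC Bu; rewrite /pvm_range /= -Bu -pvmI // BC.
Qed.

Lemma pvm_range_compl B u : measurable B -> pvm_range (~` B) u <-> P B u = 0.
Proof.
move=> mB; have mC := measurableC mB; split=> [Bu|Bu].
  by rewrite -Bu pvm_disjoint // setICr.
by have := pvm_compl u mB; rewrite Bu add0r.
Qed.

Lemma pvm_range_orth B x y : measurable B -> pvm_range B x -> pvm_range (~` B) y ->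
  ip x y = 0.
Proof.
move=> mB Bx /(pvm_range_compl _ mB) By.
by rewrite -Bx pvm_sym // By linear0r.
Qed.

(** [P C] maps the two orthogonal ranges to themselves. *)
Lemma scalar_measureD B x y : measurable B -> pvm_range B x -> pvm_range (~` B) y ->
  forall C, measurable C -> mu (x + y) C = (mu x C + mu y C)%E.
Proof.
move=> mB Bx By C mC; rewrite !scalar_measureE // pvmD // -EFinD nrm_pythagoras //.
rewrite pvm_sym // -pvmI // setIid.
apply: (pvm_range_orth mB Bx).
have mB' := measurableC mB.
by rewrite /pvm_range /= -pvmI // setIC pvmI // By.
Qed.

Section SpectralOperator.
Variables (A : operator H) (A_sa : self_adjoint ip A).
Hypothesis PA : forall u, odom A u <-> (second_moment (mu u) < +oo)%E.
Hypothesis PAE : forall u, odom A u ->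
  first_moment (mu u) = (complex.Re (ip (A u) u))%:E.

Lemma second_moment_ge0 u : (0 <= second_moment (mu u))%E.
Proof. by apply: integral_ge0 => x _; rewrite lee_fin sqr_ge0. Qed.

Lemma odom_pvm B u : measurable B -> odom A u -> odom A (P B u).
Proof.
move=> mB /PA; rewrite -{1}(pvm_compl u mB).
rewrite (second_moment_add
  (scalar_measureD mB (pvm_range_P _ mB) (pvm_range_P _ (measurableC mB)))).
move=> h; apply/PA; apply: le_lt_trans h.
by rewrite leeDl // second_moment_ge0.
Qed.

(** Additivity of the scalar measures makes the first moment, i.e. the quadratic
    form of [A], additive on [x + y]; so the real part of the cross term
    vanishes, and with ['i *: y] for [y] its imaginary part too. *)
Lemma reducing_cross B x y : measurable B -> pvm_range B x -> pvm_range (~` B) y ->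
  odom A x -> odom A y -> ip (A x) y = 0.
Proof.
move=> mB Bx.
have reP y' : pvm_range (~` B) y' -> odom A x -> odom A y' -> complex.Re (ip (A x) y') = 0.
  move=> By Dx Dy.
  have := first_moment_add (scalar_measureD mB Bx By) (scalar_measureT_lty x)
    (scalar_measureT_lty y') (proj1 (PA x) Dx) (proj1 (PA y') Dy).
  rewrite !PAE //; last exact: odomD.
  rewrite -EFinD => -[]; rewrite oappD // !linearDl /= !linearDr /=.
  rewrite (self_adjoint_sym A_sa Dy Dx) (ipC ip (A x) y').
  by case: (ip (A x) x) (ip (A x) y') (ip (A y') y') => ? ? [? ?] [? ?] /=; lra.
move=> By Dx Dy; have := reP y By Dx Dy.
have Biy : pvm_range (~` B) ('i%C *: y).
  by rewrite /pvm_range /= pvmZ ?By //; exact: measurableC.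
have := reP _ Biy Dx (odomZ A_sa _ Dy); rewrite ipZr.
case: (ip (A x) y) => s t /=; rewrite mul0r mulN1r opprK add0r => -> ->.
by [].
Qed.

(** By [reducing_cross], [P (~` B) (A x)] is orthogonal to the domain of [A],
    which is dense. *)
Lemma oapp_pvm_range B x : measurable B -> pvm_range B x -> odom A x ->
  pvm_range B (A x).
Proof.
move=> mB Bx Dx; have mC := measurableC mB.
suff g0 : P (~` B) (A x) = 0.
  by have := pvm_compl (A x) mB; rewrite g0 addr0.
apply: (adjoint_graph0 A_sa) => u Du; rewrite linear0r -pvm_sym //.
rewrite (ipC ip (A x)) (reducing_cross mB) ?conjc0 //; first exact: pvm_range_P.
exact: odom_pvm.
Qed.

Lemma pvm_range_null B x : measurable B -> pvm_range B x -> mu x (~` B) = 0%E.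
Proof.
move=> mB Bx; rewrite scalar_measureE; last exact: measurableC.
have -> : P (~` B) x = 0.
  by apply/(pvm_range_compl _ (measurableC mB)); rewrite setCK.
by rewrite nrm0 expr0n.
Qed.

Lemma pvm_range_le B (h : R) x : measurable B -> pvm_range B x -> odom A x ->
  (forall t : R, B t -> t <= h) -> complex.Re (ip (A x) x) <= h * nrm x ^+ 2.
Proof.
move=> mB Bx Dx Bh; rewrite -lee_fin -PAE // EFinM.
have := first_moment_le mB (scalar_measureT_lty x) (proj1 (PA x) Dx)
  (pvm_range_null mB Bx) Bh.
by rewrite scalar_measureE // Bx.
Qed.

Lemma pvm_range_ge B (l : R) x : measurable B -> pvm_range B x -> odom A x ->
  (forall t : R, B t -> l <= t) -> l * nrm x ^+ 2 <= complex.Re (ip (A x) x).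
Proof.
move=> mB Bx Dx Bl; rewrite -lee_fin -PAE // EFinM.
have := first_moment_ge mB (scalar_measureT_lty x) (proj1 (PA x) Dx)
  (pvm_range_null mB Bx) Bl.
by rewrite scalar_measureE // Bx.
Qed.

Lemma pvm_range_odom B (M : R) x : measurable B -> pvm_range B x ->
  (forall t : R, B t -> `|t| <= M) -> odom A x.
Proof.
move=> mB Bx BM; apply/PA.
exact: (second_moment_bounded mB (scalar_measureT_lty x) (pvm_range_null mB Bx) BM).
Qed.

Lemma pvm_range_near B (c r : R) x : 0 < r -> measurable B ->
  (forall t : R, B t -> `|t - c| <= r) -> pvm_range B x ->
  odom A x /\ nrm (A x - c%:C *: x) <= r * nrm x.
Proof.
move=> r0 mB Bc Bx.
have BD y : pvm_range B y -> odom A y.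
  move=> By; apply: (@pvm_range_odom B (r + `|c|)) => // t Bt.
  rewrite -[t](subrK c); apply: le_trans (ler_normD _ _) _.
  by rewrite lerD2r; exact: Bc.
split; first exact: BD.
apply: (self_adjoint_bound A_sa r0 (pvm_range_subspace mB) BD) => // y By.
  by apply: oapp_pvm_range => //; exact: BD.
have := @pvm_range_le B (c + r) y mB By (BD y By).
have := @pvm_range_ge B (c - r) y mB By (BD y By).
rewrite !mulrDl !mulNr ler_norml => h1 h2; apply/andP; split.
  rewrite lerBrDl; apply: h1 => t /Bc; rewrite ler_norml => /andP[]; lra.
rewrite lerBlDl; apply: h2 => t /Bc; rewrite ler_norml => /andP[]; lra.
Qed.

(** Cauchy-Schwarz for [<(A - c) x, x>]. *)
Lemma nrm_shift_ge x (c d : R) : odom A x -> 0 <= d ->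
  d * nrm x ^+ 2 <= `|complex.Re (ip (A x) x) - c * nrm x ^+ 2| ->
  d * nrm x <= nrm (A x - c%:C *: x).
Proof.
move=> Dx d0 dx.
have [x0|x0] := eqVneq (nrm x) 0; first by rewrite x0 mulr0 seminorm_ge0.
have x1 : 0 < nrm x by rewrite lt_def x0 seminorm_ge0.
rewrite -(ler_pM2r x1) -mulrA -expr2; apply: le_trans dx _.
have := form_CauchySchwarz_Re (ip_form_psd ip)
  (I : fdom (ip_form ip) (A x - c%:C *: x)) (I : fdom (ip_form ip) x).
rewrite /= linearBl /= ipZl ip_nrm.
by case: (ip (A x) x) => s t /=; rewrite !mul0r subr0.
Qed.

(** On the range of the projection to the interval, [A - l] has norm at most
    [d], while its inverse has norm at most [M]; for [M d < 1] this forces the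
    range to be zero. *)
Lemma resolvent_pvm_null (l : R) : resolvent_set A l%:C ->
  exists2 d : R, 0 < d & forall u, P `[l - d, l + d]%classic u = 0.
Proof.
case=> S cS [_ SA]; have [M M0 SM] := continuous_linear_nrm_bounded hip cS.
exists (2 * M)^-1 => [|u]; first by rewrite invr_gt0 mulr_gt0.
set d := _^-1; have d0 : 0 < d by rewrite invr_gt0 mulr_gt0.
set B := `[_, _]%classic; have mB : measurable (B : set RT) by exact: measurable_itv.
set x := P B u; have Bx : pvm_range B x by exact: pvm_range_P.
have [Dx Ax] : odom A x /\ nrm (A x - l%:C *: x) <= d * nrm x.
  apply: (pvm_range_near d0 mB) => // t; rewrite /B /= in_itv /= => /andP[t1 t2].
  by rewrite ler_norml; apply/andP; split; lra.
have := SM (A x - l%:C *: x); rewrite SA // => h.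
apply: (@nrm_eq0 _ _ ip); apply/eqP; rewrite eq_le seminorm_ge0 andbT.
have : nrm x <= M * (d * nrm x) by apply: le_trans h _; rewrite ler_pM2l.
rewrite mulrA (_ : M * d = 2^-1); last by rewrite /d; field; rewrite gt_eqF.
by lra.
Qed.

Section Window.
Variables (a b : R) (ltab : a < b).
Hypotheses (rho_a : resolvent_set A a%:C) (rho_b : resolvent_set A b%:C).
Let W : set RT := `[a, b]%classic.
Let mW : measurable W. Proof. exact: measurable_itv. Qed.
Let c := (a + b) / 2.
Let r := (b - a) / 2.

(** The [d]-neighbourhoods of [a] and [b] are null sets, so sets may be compared
    up to them; [d < r] keeps [r - d] positive. *)
Lemma pvm_window_gap : exists2 d : R, 0 < d < r &
  forall B C, measurable B -> measurable C ->
    (forall t : R, B t -> d < `|t - a| -> d < `|t - b| -> C t) ->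
    forall x, pvm_range B x -> pvm_range C x.
Proof.
have [d1 d10 Pa] := resolvent_pvm_null rho_a.
have [d2 d20 Pb] := resolvent_pvm_null rho_b.
have r0 : 0 < r by rewrite divr_gt0 // subr_gt0.
pose d := Num.min (Num.min d1 d2) (r / 2).
have d0 : 0 < d by rewrite !lt_min d10 d20 divr_gt0.
have dd1 : d <= d1 by rewrite !ge_min lexx.
have dd2 : d <= d2 by rewrite !ge_min lexx orbT.
have dr : d <= r / 2 by rewrite !ge_min lexx !orbT.
exists d; first by rewrite d0; lra.
move=> B C mB mC BC x Bx.
pose Na : set RT := `[a - d1, a + d1]%classic; pose Nb : set RT := `[b - d2, b + d2]%classic.
have mNa : measurable Na by exact: measurable_itv.
have mNb : measurable Nb by exact: measurable_itv.
have ga u : P (~` Na) u = u by have := pvm_compl u mNa; rewrite Pa add0r.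
have gb u : P (~` Nb) u = u by have := pvm_compl u mNb; rewrite Pb add0r.
have mG : measurable (B `&` (~` Na `&` ~` Nb)).
  by apply: measurableI => //; apply: measurableI; exact: measurableC.
apply: (@pvm_rangeS (B `&` (~` Na `&` ~` Nb))) => //.
  move=> t [Bt [/= /negP na /negP nb]]; apply: BC => //.
    rewrite ltNge; apply: contra na; rewrite in_itv /= ler_norml => /andP[t1 t2].
    by apply/andP; split; lra.
  rewrite ltNge; apply: contra nb; rewrite in_itv /= ler_norml => /andP[t1 t2].
  by apply/andP; split; lra.
rewrite /pvm_range /= pvmI //; last by apply: measurableI; exact: measurableC.
by rewrite pvmI; [rewrite gb ga|exact: measurableC|exact: measurableC].
Qed.

(** Outside the window the quadratic form of [A - c] has no sign, so the lower
    bound on [|(A - c) x|] is proved separately on the spectral subspaces of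
    the half-lines below [a - d] and above [b + d], which [A] preserves. *)
Lemma spectral_window : exists2 d : R, 0 < d < r &
  (forall x, P W x = x -> [/\ odom A x, P W (A x) = A x &
      nrm (A x - c%:C *: x) <= (r - d) * nrm x]) /\
  (forall x, P W x = 0 -> odom A x -> (r + d) * nrm x <= nrm (A x - c%:C *: x)).
Proof.
have [d /andP[d0 dr] gap] := pvm_window_gap.
exists d; first by rewrite d0.
split=> [x Wx|x Wx Dx].
  have mW' : measurable (`[a + d, b - d]%classic : set RT) by exact: measurable_itv.
  have Wx' : pvm_range `[a + d, b - d]%classic x.
    apply: gap Wx => // t; rewrite /W /= !in_itv /= => /andP[at' tb].
    rewrite ger0_norm ?subr_ge0 // ler0_norm ?subr_le0 // => h1 h2.
    by apply/andP; split; lra.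
  have [Dx Ax] : odom A x /\ nrm (A x - c%:C *: x) <= (r - d) * nrm x.
    apply: (pvm_range_near _ mW' _ Wx'); first by rewrite subr_gt0.
    move=> t; rewrite /= in_itv /= => /andP[t1 t2].
    by rewrite ler_norml /c /r; apply/andP; split; lra.
  by split => //; exact: oapp_pvm_range.
pose Lo : set RT := `]-oo, a - d]%classic.
have mLo : measurable Lo by exact: measurable_itv.
have mHi : measurable (`[b + d, +oo[%classic : set RT) by exact: measurable_itv.
pose x1 := P Lo x; pose x2 := P (~` Lo) x.
have xE : x1 + x2 = x := pvm_compl x mLo.
have Lx1 : pvm_range Lo x1 by exact: pvm_range_P.
have Lx2 : pvm_range (~` Lo) x2 by apply: pvm_range_P; exact: measurableC.
have Dx1 : odom A x1 by exact: odom_pvm.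
have Dx2 : odom A x2 by apply: odom_pvm => //; exact: measurableC.
have Hx2 : pvm_range `[b + d, +oo[%classic x2.
  apply: (gap (~` Lo `&` ~` W)) => //.
  - by apply: measurableI; exact: measurableC.
  - move=> t [/negP]; rewrite /Lo /= in_itv /= -ltNge => t1 /negP.
    rewrite /W /= in_itv /= negb_and -!ltNge => /orP[ta|bt].
      by rewrite ler0_norm ?subr_le0 ?ltW // => h1; lra.
    move=> _; rewrite ger0_norm ?subr_ge0 ?ltW // => h1.
    by rewrite in_itv /= andbT; lra.
  rewrite /pvm_range /= pvmI; [|exact: measurableC|exact: measurableC].
  have -> : P (~` W) x2 = x2.
    rewrite /x2 -pvmI; [|exact: measurableC|exact: measurableC].
    rewrite setIC pvmI; [|exact: measurableC|exact: measurableC].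
    by have /(pvm_range_compl _ mW) -> := Wx.
  exact: Lx2.
have r0 : 0 < r by lra.
have n1 : (r + d) * nrm x1 <= nrm (A x1 - c%:C *: x1).
  apply: nrm_shift_ge => //; first lra.
  have := @pvm_range_le Lo (a - d) x1 mLo Lx1 Dx1; set X := complex.Re _.
  move=> h; have : X <= (a - d) * nrm x1 ^+ 2 by apply: h => t; rewrite /Lo /= in_itv.
  move=> {}h; rewrite -normrN; apply: le_trans (ler_norm _).
  by move: h; rewrite /c /r; lra.
have n2 : (r + d) * nrm x2 <= nrm (A x2 - c%:C *: x2).
  apply: nrm_shift_ge => //; first lra.
  have := @pvm_range_ge _ (b + d) x2 mHi Hx2 Dx2; set X := complex.Re _.
  move=> h; have : (b + d) * nrm x2 ^+ 2 <= X by apply: h => t; rewrite /= in_itv /= andbT.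
  move=> {}h; apply: le_trans (ler_norm _).
  by move: h; rewrite /c /r; lra.
have AE : A x - c%:C *: x = (A x1 - c%:C *: x1) + (A x2 - c%:C *: x2).
  by rewrite -xE oappD // scalerDr opprD addrACA.
have o12 : ip (A x1 - c%:C *: x1) (A x2 - c%:C *: x2) = 0.
  have sub B y : measurable B -> pvm_range B y -> odom A y -> pvm_range B (A y - c%:C *: y).
    move=> mB By Dy; rewrite addrC -scaleNr; apply: (pvm_range_subspace mB).2 => //.
    exact: oapp_pvm_range.
  apply: (pvm_range_orth mLo); first exact: sub.
  by apply: sub => //; exact: measurableC.
have x12 : ip x1 x2 = 0 by exact: (pvm_range_orth mLo).
rewrite -ler_sqr ?nnegrE ?mulr_ge0 ?seminorm_ge0 //; try lra.
have nx : nrm x ^+ 2 = nrm x1 ^+ 2 + nrm x2 ^+ 2 by rewrite -nrm_pythagoras // xE.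
rewrite AE nrm_pythagoras // exprMn nx mulrDr -!exprMn.
by apply: lerD; rewrite ler_sqr ?nnegrE ?mulr_ge0 ?seminorm_ge0 //; lra.
Qed.

(** Decompose [u = S w] by [P W]: its component [x] in the window satisfies
    [(A - z) x = P W w = 0]. *)
Lemma resolvent_window (z : R[i]) (S : H -> H) :
  (forall w, odom A (S w) /\ A (S w) - z *: S w = w) ->
  (forall u, odom A u -> S (A u - z *: u) = u) ->
  forall w, P W w = 0 -> P W (S w) = 0.
Proof.
move=> SA AS w Ww; have [Du Eu] := SA w; set u := S w in Du Eu *.
pose x := P W u; pose y := P (~` W) u; have mC := measurableC mW.
have xE : x + y = u := pvm_compl u mW.
have Wx : pvm_range W x by exact: pvm_range_P.
have Wy : pvm_range (~` W) y by exact: pvm_range_P.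
have Dx : odom A x by exact: odom_pvm.
have Dy : odom A y by exact: odom_pvm.
have S0 : S 0 = 0.
  have D0 := (odom_subspace A_sa).1.
  by have := AS 0 D0; rewrite oapp0 // scaler0 subrr.
have sub B v : measurable B -> pvm_range B v -> odom A v -> pvm_range B (A v - z *: v).
  move=> mB Bv Dv; rewrite addrC -scaleNr; apply: (pvm_range_subspace mB).2 => //.
  exact: oapp_pvm_range.
have wE : w = (A x - z *: x) + (A y - z *: y).
  by rewrite -Eu -xE oappD // scalerDr opprD addrACA.
have : P W w = A x - z *: x.
  rewrite wE pvmD // (sub W x) //.
  by have /(pvm_range_compl _ mW) -> := sub _ _ mC Wy Dy; rewrite addr0.
by rewrite Ww => /esym E; rewrite -/x -(AS x Dx) E S0.
Qed.

End Window.
End SpectralOperator.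
End Pvm.
End Spectral.

(** * Convergence of the Galerkin projections *)

Section Iteration.
Context {R : realType} {X : Type}.

(** [limsup f n v <= limsup f n (G v) <= ... <= N (G^k v) <= th ^ k N v] for all
    [k]. *)
Lemma iterate_contraction (K : set X) (G : X -> X) (N : X -> R) (th : R)
    (f e : nat -> X -> R) :
  0 <= th < 1 -> (forall n v, 0 <= f n v <= N v) ->
  (forall v, K v -> [/\ K (G v), N (G v) <= th * N v,
     forall n, f n v <= f n (G v) + e n v & e n v @[n --> \oo] --> (0 : R)]) ->
  forall v, K v -> f n v @[n --> \oo] --> (0 : R).
Proof.
move=> /andP[th0 th1] fN KG.
have iter k : forall v, K v -> forall eps, 0 < eps ->
    \forall n \near \oo, f n v <= th ^+ k * N v + eps.
  elim: k => [|k IH] v Kv eps eps0.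
    near=> n; rewrite expr0 mul1r; have /andP[_ h] := fN n v.
    by apply: le_trans h _; rewrite lerDl ltW.
  have [KGv NGv fG ev] := KG v Kv.
  have eps2 : 0 < eps / 2 by rewrite divr_gt0.
  near=> n; apply: le_trans (fG n) _.
  have h1 : f n (G v) <= th ^+ k * N (G v) + eps / 2.
    by near: n; exact: IH.
  have h2 : e n v <= eps / 2.
    by near: n; apply: (cvgr_le _ ev).
  have h3 : th ^+ k * N (G v) <= th ^+ k.+1 * N v.
    by rewrite exprSr -mulrA ler_wpM2l ?exprn_ge0.
  by lra.
move=> v Kv; apply/cvgr0Pnorm_le => eps eps0.
have eps2 : 0 < eps / 2 by rewrite divr_gt0.
have : th ^+ k * N v @[k --> \oo] --> (0 : R).
  rewrite -[X in _ --> X](mul0r (N v)); apply: cvgMl; apply: cvg_expr.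
  by rewrite ger0_norm.
move=> /cvgr_le /(_ _ eps2) [k _ /(_ k (leqnn k)) hk].
near=> n; have /andP[f0 _] := fN n v; rewrite ger0_norm //.
have : f n v <= th ^+ k * N v + eps / 2 by near: n; exact: iter.
by rewrite /= in hk; lra.
Unshelve. all: by end_near.
Qed.

Lemma le_sqrtD (t al be : R) : 0 <= al -> 0 <= be -> t ^+ 2 <= al + be * t ->
  t <= Num.sqrt al + be.
Proof.
move=> al0 be0 h; rewrite leNgt; apply/negP => ht.
have s0 := sqrtr_ge0 al; have s2 := sqr_sqrtr al0.
by set s := Num.sqrt al in ht s0 s2; nra.
Qed.

End Iteration.

Section Main.
Context {R : realType} {H : completeNormedModType R[i]}.
Variable ip : {dot H for @Num.conj R[i]}.
Hypothesis hip : norm_from_ip ip.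
Variables (A : operator H) (A_sa : self_adjoint ip A).
Variables (q : sform R H) (Aq : form_of ip A q) (m : R) (hm : is_min_spectrum A m).
Variables (a b : R) (ltab : a < b).
Hypotheses (rho_a : resolvent_set A a%:C) (rho_b : resolvent_set A b%:C).
Variables (P : set R -> H -> H) (hP : spectral_measure_of ip A P).
Variables (L : nat -> set H) (L_fin : forall n, finite_dim (L n))
  (L_dom : forall n, L n `<=` fdom q).
Local Notation nrm := (seminorm (ip_form ip)).
Local Notation energy := (seminorm (energy_form ip q m)).
Hypothesis L_approx : forall u, fdom q u ->
  exists2 w : nat -> H, forall n, L n (w n) & energy (u - w n) @[n --> \oo] --> (0 : R).
Variables (An : nat -> operator H) (hAn : forall n, galerkin_op ip q (L n) (An n)).
Variables (Q : nat -> H -> H).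
Hypothesis hQ : forall n, orth_proj ip (eigen_span (An n) `[a, b]%classic) (Q n).

Let hq : hermitian_form q. Proof. by case: Aq. Qed.
Let qm : form_ge ip q m. Proof. exact: form_ge_min_spectrum hm. Qed.
Let hE : psd_form (energy_form ip q m).
Proof.
apply: energy_form_psd => // w dw; apply: le_trans (qm dw).
by rewrite ler_wpM2r ?sqr_ge0 //; lra.
Qed.

Let Q_sub n w : L n (Q n w).
Proof. exact: (galerkin_proj_sub hq (@L_dom n) (L_fin n) (hAn n) (hQ n)). Qed.

Let fdom_Q n w : fdom q (Q n w).
Proof. by apply: (@L_dom n); exact: Q_sub. Qed.

Let QB n u v : Q n (u - v) = Q n u - Q n v.
Proof. exact: (galerkin_projB hq (@L_dom n) (L_fin n) (hAn n) (hQ n)). Qed.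

Let c := (a + b) / 2.
Let r := (b - a) / 2.
Let rho := Num.sqrt (r ^+ 2 + 1).
Let z := c +i* 1.

Let rho2 : rho ^+ 2 = r ^+ 2 + 1 ^+ 2.
Proof. by rewrite expr1n sqr_sqrtr // addr_ge0 ?sqr_ge0. Qed.

Let rho_gt0 : 0 < rho.
Proof. by rewrite sqrtr_gt0 ltr_wpDl ?sqr_ge0. Qed.

(** The spectrum is bounded below by [m] in the order of [R[i]], where
    comparable numbers have equal imaginary parts; so it is real. *)
Lemma nonreal_resolvent : exists S : {linear H -> H},
  (forall w, odom A (S w) /\ A (S w) - z *: S w = w) /\
  (forall u, odom A u -> S (A u - z *: u) = u).
Proof.
have [S _ hS] : resolvent_set A z.
  apply: contrapT => nz; have := hm.2 z nz.
  by rewrite lecE /= oner_eq0.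
by exists S.
Qed.

(** [G n] is the Galerkin resolvent at [z]; its scaling by [rho] is the [F_n] of
    the introduction. *)
Lemma galerkin_resolvent_cvg : exists2 G : nat -> H -> H,
  forall n w, [/\ L n (G n w), nrm (Q n w) <= rho * nrm (Q n (G n w)) &
      rho * nrm (G n w - Q n (G n w)) <= nrm (w - Q n w)] &
  forall w u, odom A u -> A u - z *: u = w ->
    nrm (u - G n w) @[n --> \oo] --> (0 : R).
Proof.
have /choice[G hG] : forall n, exists G : H -> H, forall w,
  [/\ L n (G w),
      forall v, L n v -> q (G w) v - z * ip (G w) v = ip w v,
      nrm (Q n w) <= rho * nrm (Q n (G w)) &
      rho * nrm (G w - Q n (G w)) <= nrm (w - Q n w)].
  move=> n; exact: (galerkin_resolvent hq (@L_dom n) (L_fin n) (hAn n) ltab (hQ n)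
    erefl ltr01 rho_gt0 rho2).
exists G => [n w|w u Du Eu]; first by have [] := hG n w.
have du := form_of_fdom Aq Du.
have [C C0 hC] := cea_estimate hq qm c (@ltr01 R).
have [g Lg g0] := L_approx du.
apply: (@squeeze_cvgr _ _ _ _ (fun=> 0) (fun n => C * energy (u - g n))).
- near=> n; rewrite seminorm_ge0 /=.
  have [LG qG _ _] := hG n w.
  apply: le_trans (nrm_le_energy qm (fdomB hq du (L_dom LG))) _.
  apply: (hC (L n)) => //; first exact: (galerkin_subspace (hAn n)).
  move=> v Lv; have dv := L_dom Lv.
  have E1 : q u v - z * ip u v = ip w v.
    by rewrite (form_ofE Aq Du dv) -Eu linearBl /= ipZl.
  rewrite (formBl hq du (L_dom LG) dv) linearBl /= -/z mulrBr.
  have -> : q u v = ip w v + z * ip u v by rewrite -E1 subrK.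
  have -> : q (G n w) v = ip w v + z * ip (G n w) v by rewrite -(qG v Lv) subrK.
  by ring.
- exact: cvg_cst.
- by rewrite -[X in _ --> X](mulr0 C); apply: cvgMr.
Unshelve. all: by end_near.
Qed.

Let W : set R := `[a, b]%classic.

(** Iterate the contraction [rho (A - z)^-1] of the kernel of [P W]. *)
Lemma proj_cvg_outside : forall v, P W v = 0 -> nrm (Q n v) @[n --> \oo] --> (0 : R).
Proof.
case: hP => mu [Pmu PA PAE].
have [d /andP[d0 dr] [_ outer]] := spectral_window hip Pmu A_sa PA PAE ltab rho_a rho_b.
have [S [SA AS]] := nonreal_resolvent.
have [G hG Gcvg] := galerkin_resolvent_cvg.
pose sg := Num.sqrt ((r + d) ^+ 2 + 1).
have sg2 : sg ^+ 2 = (r + d) ^+ 2 + 1 by rewrite sqr_sqrtr // addr_ge0 ?sqr_ge0.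
have sg0 : 0 < sg by rewrite sqrtr_gt0 ltr_wpDl ?sqr_ge0.
have rsg : rho < sg.
  rewrite -ltr_sqr ?nnegrE ?ltW // rho2 sg2 expr1n ltrD2r; rewrite -/r in dr; nra.
apply: (@iterate_contraction R H [set v | P W v = 0] (fun v => rho%:C *: S v) nrm (rho / sg)
  (fun n v => nrm (Q n v)) (fun n v => rho * nrm (S v - G n v))).
- by rewrite divr_ge0 ?ltW //= ltr_pdivrMr // mul1r.
- by move=> n v; rewrite seminorm_ge0 (nrm_orth_proj (hQ n)).
- move=> v /= Wv; have [Dx Ex] := SA v.
  have Wx : P W (S v) = 0 by exact: (resolvent_window Pmu A_sa PA PAE SA AS).
  split.
  + by rewrite (pvmZ Pmu) ?Wx ?scaler0 //; exact: measurable_itv.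
  + rewrite nrmZ_real gtr0_norm // mulrAC ler_pdivlMr // -mulrA ler_pM2l //.
    rewrite -ler_sqr ?nnegrE ?mulr_ge0 ?seminorm_ge0 ?(ltW sg0) // exprMn sg2.
    rewrite -[in leRHS]Ex (nrm_shift_complex A_sa) // expr1n mul1r mulrC mulrDl mul1r lerD2r.
    rewrite -exprMn ler_sqr ?nnegrE ?mulr_ge0 ?seminorm_ge0 //; first exact: outer.
    by rewrite addr_ge0 // ltW // (lt_trans d0).
  + move=> n; have [_ h _] := hG n v; apply: le_trans h _.
    rewrite (galerkin_projZ hq (@L_dom n) (L_fin n) (hAn n) (hQ n)) nrmZ_real gtr0_norm //.
    rewrite -mulrDr ler_pM2l //.
    have -> : Q n (G n v) = Q n (S v) - Q n (S v - G n v).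
      rewrite QB.
      by rewrite opprB addrC subrK.
    apply: le_trans (nrmB _ _ _) _; rewrite lerD2l.
    exact: (nrm_orth_proj (hQ n)).
  + by rewrite -[X in _ --> X](mulr0 rho); apply: cvgMr; exact: Gcvg.
Qed.

(** Iterate the contraction [rho^-1 (A - z)] of the range of [P W]. *)
Lemma proj_cvg_inside : forall v, P W v = v -> nrm (v - Q n v) @[n --> \oo] --> (0 : R).
Proof.
case: hP => mu [Pmu PA PAE].
have [d /andP[d0 dr] [inner _]] := spectral_window hip Pmu A_sa PA PAE ltab rho_a rho_b.
have [G hG Gcvg] := galerkin_resolvent_cvg.
pose sg := Num.sqrt ((r - d) ^+ 2 + 1).
have sg2 : sg ^+ 2 = (r - d) ^+ 2 + 1 by rewrite sqr_sqrtr // addr_ge0 ?sqr_ge0.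
have sg0 : 0 < sg by rewrite sqrtr_gt0 ltr_wpDl ?sqr_ge0.
have rsg : sg < rho.
  rewrite -ltr_sqr ?nnegrE ?ltW // rho2 sg2 expr1n ltrD2r; rewrite -/r in dr; nra.
have mW : measurable (W : set (measurableTypeR R)) by exact: measurable_itv.
apply: (@iterate_contraction R H [set v | P W v = v]
  (fun v => rho^-1%:C *: (A v - z *: v)) nrm (sg / rho)
  (fun n v => nrm (v - Q n v)) (fun n v => nrm (v - G n (A v - z *: v)))).
- by rewrite divr_ge0 ?ltW //= ltr_pdivrMr // mul1r.
- by move=> n v; rewrite seminorm_ge0 (nrm_orth_projC (hQ n)).
- move=> v /= Wv; have [Dv WAv nAv] := inner v Wv.
  set w := A v - z *: v.
  have Ww : P W w = w.
    by rewrite /w addrC -scaleNr (pvm_lin Pmu) // Wv WAv.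
  split.
  + by rewrite (pvmZ Pmu) // Ww.
  + rewrite nrmZ_real gtr0_norm ?invr_gt0 // mulrC mulrAC ler_pM2r ?invr_gt0 //.
    rewrite -ler_sqr ?nnegrE ?mulr_ge0 ?seminorm_ge0 ?(ltW sg0) // exprMn sg2.
    rewrite (nrm_shift_complex A_sa) // expr1n mul1r mulrDl mul1r lerD2r.
    by rewrite -exprMn ler_sqr ?nnegrE ?mulr_ge0 ?seminorm_ge0 ?subr_ge0 ?(ltW dr).
  + move=> n; have [_ _ h] := hG n w.
    rewrite (galerkin_projZ hq (@L_dom n) (L_fin n) (hAn n) (hQ n)) -scalerBr nrmZ_real.
    rewrite gtr0_norm ?invr_gt0 // mulrC -lerBlDr ler_pdivlMr // mulrC.
    apply: le_trans h; rewrite ler_pM2l // lerBlDr.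
    have {1}-> : v - Q n v = (G n w - Q n (G n w)) + (v - G n w - Q n (v - G n w)).
      rewrite QB.
      by rewrite addrACA subrKC opprB addKr.
    apply: le_trans (nrmD _ _ _) _; rewrite lerD2l.
    exact: (nrm_orth_projC (hQ n)).
  + exact: Gcvg.
Qed.

Variables (E : H -> H) (E_proj : orth_proj ip (spectral_subspace P W) E).

Lemma spectral_proj_eq u : E u = P W u.
Proof.
case: hP => mu [Pmu PA PAE].
have mW : measurable (W : set (measurableTypeR R)) by exact: measurable_itv.
apply: (orth_proj_uniq E_proj); first by exists u.
move=> _ [v _ <-]; rewrite -(pvm_sym Pmu) // -scaleN1r addrC (pvm_lin Pmu) //.
by rewrite (pvm_idem Pmu) // scaleN1r addNr linear0l.
Qed.

Let C1 := Num.sqrt `|b - m + 1|.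

Lemma energy_proj_le n w : energy (Q n w) <= C1 * nrm (Q n w).
Proof.
have dQ := fdom_Q n w.
rewrite -ler_sqr ?nnegrE ?mulr_ge0 ?seminorm_ge0 ?sqrtr_ge0 // exprMn.
rewrite [C1 ^+ 2]sqr_sqrtr // (sqr_seminorm hE) // energy_formE.
have := galerkin_proj_form_le hq (@L_dom n) (L_fin n) (hAn n) (hQ n) w.
have : (b - m + 1) * nrm (Q n w) ^+ 2 <= `|b - m + 1| * nrm (Q n w) ^+ 2.
  by rewrite ler_wpM2r ?sqr_ge0 // ler_norm.
by lra.
Qed.

(** [y = w - Q n w] is estimated by the identity
    [<y, y>_a = <w, y>_a = <v, y>_a - <v - w, y>_a], the rest [h] by the uniform
    boundedness of [Q n] from [H] to the form domain. *)
Lemma energy_compl_le n v w : odom A v -> L n w ->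
  energy (v - Q n v) <=
    Num.sqrt (nrm (A v - (m - 1)%:C *: v) * (nrm (v - Q n v) + energy (v - w)))
    + (2 + C1) * energy (v - w).
Proof.
move=> Dv Lw; have dv := form_of_fdom Aq Dv; have dw := L_dom Lw.
have dQ := fdom_Q n.
have dvw : fdom q (v - w) by exact: fdomB.
have nvw := nrm_le_energy qm dvw.
set y := w - Q n w.
have dy : fdom q y by exact: fdomB.
set h := (v - w) - Q n (v - w).
have dh : fdom q h by exact: fdomB.
have vE : v - Q n v = y + h.
  by rewrite /y /h QB addrACA subrKC opprB addKr.
have yE : y = (v - Q n v) - h by rewrite vE addrK.
have nh : nrm h <= energy (v - w).
  by apply: le_trans nvw; exact: (nrm_orth_projC (hQ n)).
have eh : energy h <= (1 + C1) * energy (v - w).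
  apply: le_trans (ler_seminormB hE dvw (dQ _)) _; rewrite mulrDl mul1r lerD2l.
  apply: le_trans (energy_proj_le _ _) _; apply: ler_wpM2l; first exact: sqrtr_ge0.
  by apply: le_trans nvw; exact: (nrm_orth_proj (hQ n)).
have ny : nrm y <= nrm (v - Q n v) + energy (v - w).
  by rewrite yE; apply: le_trans (nrmB _ _ _) _; rewrite lerD2l.
have ey : energy y ^+ 2 <= nrm (A v - (m - 1)%:C *: v) * nrm y + energy (v - w) * energy y.
  rewrite (sqr_seminorm hE) //.
  have -> : energy_form ip q m y y = energy_form ip q m v y - energy_form ip q m (v - w) y.
    rewrite -(formBl hE.1) // opprB addrC subrK.
    rewrite (formBl hE.1 dw (dQ w) dy).
    suff -> : energy_form ip q m (Q n w) y = 0 by rewrite subr0.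
    rewrite /= /form_ip (galerkin_proj_form_orth hq (@L_dom n) (L_fin n) (hAn n) (hQ n)) //.
    have [SQ wQ] := hQ n w.
    by rewrite (ipC ip y) wQ // conjc0 mulr0 subr0.
  have -> : energy_form ip q m v y = ip (A v - (m - 1)%:C *: v) y.
    by rewrite /= /form_ip (form_ofE Aq) // linearBl /= ipZl.
  have := form_CauchySchwarz_Re hE dvw dy.
  have := form_CauchySchwarz_Re (ip_form_psd ip)
    (I : fdom (ip_form ip) (A v - (m - 1)%:C *: v)) (I : fdom (ip_form ip) y).
  rewrite !ler_norml => /andP[_ h1] /andP[h2 _].
  by move: h1 h2 => /=; case: (ip _ y) (form_ip _ _ _ _ _) => ? ? [? ?] /=; lra.
have n0 := seminorm_ge0 (ip_form ip) (A v - (m - 1)%:C *: v).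
have e0 := seminorm_ge0 (energy_form ip q m) (v - w).
have y0 := seminorm_ge0 (energy_form ip q m) y.
have yle : energy y <= Num.sqrt (nrm (A v - (m - 1)%:C *: v) *
     (nrm (v - Q n v) + energy (v - w))) + energy (v - w).
  apply: le_sqrtD => //; first by rewrite mulr_ge0 // addr_ge0 // seminorm_ge0.
  by apply: le_trans ey _; rewrite lerD2r ler_wpM2l.
rewrite {1}vE; apply: le_trans (ler_seminormD hE dy dh) _.
by lra.
Qed.

Lemma galerkin_proj_cvg u : fdom q u ->
  (forall n, fdom q (Q n u - E u)) /\
  energy (Q n u - E u) @[n --> \oo] --> (0 : R).
Proof.
move=> du; case: (hP) => mu [Pmu PA PAE].
have mW : measurable (W : set (measurableTypeR R)) by exact: measurable_itv.
have [d _ [inner _]] := spectral_window hip Pmu A_sa PA PAE ltab rho_a rho_b.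
pose v := E u; pose x := u - v.
have Wv : P W v = v by rewrite /v spectral_proj_eq (pvm_idem Pmu).
have Wx : P W x = 0.
  by rewrite /x addrC -scaleN1r (pvm_lin Pmu) // Wv /v spectral_proj_eq scaleN1r addNr.
have [Dv _ _] := inner v Wv; have dv := form_of_fdom Aq Dv.
have dQ := fdom_Q.
split; first by move=> n; exact: fdomB.
have [w Lw w0] := L_approx dv.
pose M := nrm (A v - (m - 1)%:C *: v).
apply: (@squeeze_cvgr _ _ _ _ (fun=> 0) (fun n => C1 * nrm (Q n x) +
  (Num.sqrt (M * (nrm (v - Q n v) + energy (v - w n))) + (2 + C1) * energy (v - w n)))).
- near=> n; rewrite seminorm_ge0 /=.
  have -> : Q n u - E u = Q n x - (v - Q n v).
    rewrite /x QB -/v.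
    by rewrite opprB addrA subrK.
  apply: le_trans (ler_seminormB hE (dQ _ _) (fdomB hq dv (dQ _ _))) _.
  by apply: lerD; [exact: energy_proj_le|exact: energy_compl_le].
- exact: cvg_cst.
- have z0 : 0 = C1 * 0 + (Num.sqrt (M * (0 + 0)) + (2 + C1) * 0) :> R.
    by rewrite addr0 !mulr0 sqrtr0 !addr0.
  rewrite [X in _ --> X]z0; apply: cvgD; first by apply: cvgMr; exact: proj_cvg_outside.
  apply: cvgD; last exact: cvgMr.
  apply: continuous_cvg; first exact: sqrt_continuous.
  apply: cvgMr; apply: cvgD => //.
  exact: proj_cvg_inside.
Unshelve. all: by end_near.
Qed.

End Main.

Theorem lemma2p3 (R : realType) (H : completeNormedModType R[i])
    (ip : {dot H for @Num.conj R[i]}) (hip : norm_from_ip ip)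
    (A : operator H) (A_sa : self_adjoint ip A) (A_sb : semibounded_below ip A)
    (fa : sform R H) (faA : form_of ip A fa)
    (m : R) (hm : is_min_spectrum A m)
    (a b : R) (ltab : a < b)
    (rho_a : resolvent_set A a%:C) (rho_b : resolvent_set A b%:C)
    (ess_ab : forall x : R, `[a, b]%classic x -> ~ essential_spectrum A x%:C)
    (P : set R -> H -> H) (hP : spectral_measure_of ip A P)
    (E : H -> H) (hE : orth_proj ip (spectral_subspace P `[a, b]%classic) E)
    (L : nat -> set H) (L_fin : forall n, finite_dim (L n))
    (L_dom : forall n, L n `<=` fdom fa)
    (L_approx : forall u, fdom fa u ->
       exists2 w : nat -> H, forall n, L n (w n) &
         form_norm ip fa m (u - w n) @[n --> \oo] --> (0 : R))
    (An : nat -> operator H) (hAn : forall n, galerkin_op ip fa (L n) (An n))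
    (Q : nat -> H -> H)
    (hQ : forall n, orth_proj ip (eigen_span (An n) `[a, b]%classic) (Q n)) :
  forall u, fdom fa u ->
    (forall n, fdom fa (Q n u - E u)) /\
    form_norm ip fa m (Q n u - E u) @[n --> \oo] --> (0 : R).
Proof.
exact: (galerkin_proj_cvg hip A_sa faA hm ltab rho_a rho_b hP L_fin L_dom L_approx hAn hQ hE).
Qed.
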